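(* Let $\mathcal Z$ be a finite graph, and let $(\mathcal G,\mathcal Z)$ be a graph of topological groups such that: (i) for each $v\in V(\mathcal Z)$, $\mathcal H_v$ is a finite collection of subgroups of the vertex group $G_v$ such that $(G_v,\mathcal H_v)$ is a proper pair, and $G_v$ is hyperbolic relative to $\mathcal H_v$; (ii) for each $e\in E(\mathcal Z)$, the edge group $G_e$ is a compact subgroup of the adjacent vertex groups. Then the fundamental group of $(\mathcal G,\mathcal Z)$ is hyperbolic relative to $\bigcup_{v\in V(\mathcal Z)}\mathcal H_v$.
   Context: All topological groups are Hausdorff. A TDLC group is a totally disconnected locally compact group. All graphs are connected and edges have length one. A graph of topological groups $(\mathcal G,\mathcal Z)$ over a graph $\mathcal Z$ consists of a topological group $G_v$ for each vertex $v$, a topological group $G_e$ for each edge $e$, and, for each edge $e$ with endpoints $v,w$, open topological embeddings $G_e\to G_v$ and $G_e\to G_w$. Its fundamental group $\pi_1(\mathcal G,\mathcal Z)$ (in the sense of Bass-Serre theory) carries the unique group topology for which the inclusions $G_v\to\pi_1(\mathcal G,\mathcal Z)$ are open topological embeddings. A proper pair $(G,\mathcal H)$ consists of a TDLC group $G$ and a finite collection $\mathcal H$ of open subgroups such that no two distinct non-compact subgroups in $\mathcal H$ are conjugate in $G$. A Cayley-Abels graph of $G$ with respect to $\mathcal H$ (for a proper pair) is a connected simplicial graph $X$ on which $G$ acts cocompactly and discretely (pointwise stabilizers of cells are open subgroups) such that: (1) edge $G$-stabilizers are compact; (2) vertex $G$-stabilizers are either compact or conjugates of subgroups in $\mathcal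 H$; (3) every $H\in\mathcal H$ is the $G$-stabilizer of a vertex of $X$; (4) any two vertices of $X$ with the same $G$-stabilizer $H\in\mathcal H$ are in the same $G$-orbit if $H$ is non-compact. A simplicial graph is fine if for any vertices $u,v$ and any $n\in\mathbb N$ there are only finitely many embedded paths of length $n$ from $u$ to $v$. $G$ is hyperbolic relative to $\mathcal H$ if $(G,\mathcal H)$ is a proper pair and there exists a Cayley-Abels graph of $G$ with respect to $\mathcal H$ that is fine and Gromov hyperbolic. *)

(* Defs.v *)
From HB Require Import structures.
From mathcomp Require Import all_boot all_order all_algebra.
From mathcomp Require Import boolp classical_sets functions cardinality.
From mathcomp Require Import topology.

Set Implicit Arguments.
Unset Strict Implicit.
Unset Printing Implicit Defensive.

Local Open Scope classical_set_scope.
Local Open Scope group_scope.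

(** * Topological groups *)

(* All topological groups are Hausdorff. *)
HB.mixin Record isTopologicalGroup G of Group G & Topological G := {
  mulg_continuous : continuous (fun x : G * G => x.1 * x.2);
  invg_continuous : continuous (fun x : G => x^-1);
  group_hausdorff : hausdorff_space G }.

#[short(type="topologicalGroupType")]
HB.structure Definition TopologicalGroup :=
  {G of isTopologicalGroup G & Group G & Topological G}.

Definition tdlc (G : topologicalGroupType) : Prop :=
  totally_disconnected [set: G] /\ locally_compact [set: G].

Definition group_hom (G H : groupType) (f : G -> H) : Prop :=
  {morph f : x y / x * y >-> x * y}.

(* An injective, continuous and open map is the same thing as a homeomorphism
   onto an open subspace. *)
Definition open_embedding (S T : topologicalType) (f : S -> T) : Prop :=
  [/\ injective f, continuous f & forall U : set S, open U -> open (f @` U)].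

Definition is_subgroup (G : groupType) (H : set G) : Prop :=
  [/\ H 1, forall x y, H x -> H y -> H (x * y) & forall x, H x -> H x^-1].

Definition conj_set (G : groupType) (g : G) (H : set G) : set G :=
  [set g * h * g^-1 | h in H].

Definition conjugate (G : groupType) (H K : set G) : Prop :=
  exists g : G, K = conj_set g H.

Definition proper_pair (G : topologicalGroupType) (HH : set (set G)) : Prop :=
  [/\ tdlc G,
      finite_set HH,
      forall H, HH H -> is_subgroup H /\ open H &
      forall H K, HH H -> HH K -> ~ compact H -> ~ compact K ->
        conjugate H K -> H = K].

(** * Simplicial graphs

   A simplicial graph is given by its vertex set [X] and its adjacency
   relation [adj]; the metric is the path metric on [X]. *)

Section SimplicialGraphs.
Variables (X : choiceType) (adj : rel X).

Definition simplicial : Prop := symmetric adj /\ irreflexive adj.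

(* [x :: p] is the sequence of vertices of an edge path with [size p] edges. *)
Definition edge_path (x y : X) (p : seq X) : Prop :=
  path adj x p /\ last x p = y.

Definition graph_connected : Prop :=
  inhabited X /\ forall x y, exists p, edge_path x y p.

Definition fine : Prop :=
  forall (u v : X) (n : nat),
    finite_set [set p : seq X | [/\ edge_path u v p, uniq (u :: p) & size p = n]].

(* Length of a shortest edge path; the junk value 0 is taken only when [x] and
   [y] lie in different components. *)
Definition graph_dist (x y : X) : nat :=
  xget 0 [set n | (exists2 p, edge_path x y p & size p = n) /\
                  (forall p, edge_path x y p -> (n <= size p)%N)].

Local Open Scope ring_scope.

Definition gromov_product (w x y : X) : rat :=
  ((graph_dist x w)%:R + (graph_dist y w)%:R - (graph_dist x y)%:R) / 2%:R.

Definition gromov_hyperbolic : Prop :=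
  exists delta : rat, forall w x y z : X,
    Num.min (gromov_product w x y) (gromov_product w y z) - delta
      <= gromov_product w x z.

End SimplicialGraphs.

(** * Cayley-Abels graphs and relative hyperbolicity *)

Section CayleyAbels.
Variables (G : topologicalGroupType) (X : choiceType) (adj : rel X).
Variable act : G -> X -> X.

Definition acts_on_graph : Prop :=
  [/\ forall x, act 1 x = x,
      forall g h x, act (g * h) x = act g (act h x) &
      forall g x y, adj (act g x) (act g y) = adj x y].

Definition vertex_stab (x : X) : set G := [set g | act g x = x].

(* The setwise stabilizer of the edge {x, y}, which may be inverted. *)
Definition edge_stab (x y : X) : set G :=
  [set g | (act g x = x /\ act g y = y) \/ (act g x = y /\ act g y = x)].

(* Pointwise stabilizers of vertices and of edges are open. *)
Definition discrete_action : Prop :=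
  (forall x, open (vertex_stab x)) /\
  (forall x y, adj x y -> open (vertex_stab x `&` vertex_stab y)).

(* The translates of a finite subgraph cover the graph. *)
Definition cocompact_action : Prop :=
  exists (K : set X) (L : set (X * X)),
    [/\ finite_set K, finite_set L,
        forall x, exists2 k, K k & exists g, act g k = x &
        forall x y, adj x y ->
          exists2 l, L l & exists g, act g l.1 = x /\ act g l.2 = y].

Record cayley_abels (HH : set (set G)) : Prop := CayleyAbels {
  ca_simplicial : simplicial adj;
  ca_connected : graph_connected adj;
  ca_action : acts_on_graph;
  ca_cocompact : cocompact_action;
  ca_discrete : discrete_action;
  ca_edges : forall x y, adj x y -> compact (edge_stab x y);
  ca_vertices : forall x, compact (vertex_stab x) \/
    exists2 H, HH H & conjugate H (vertex_stab x);
  ca_parabolics : forall H, HH H -> exists x, vertex_stab x = H;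
  ca_orbits : forall H x y, HH H -> ~ compact H ->
    vertex_stab x = H -> vertex_stab y = H -> exists g, act g x = y }.

End CayleyAbels.

Definition hyperbolic_relative (G : topologicalGroupType) (HH : set (set G)) :
    Prop :=
  proper_pair HH /\
  exists (X : choiceType) (adj : rel X) (act : G -> X -> X),
    [/\ cayley_abels adj act HH, fine adj & gromov_hyperbolic adj].

(** * Finite graphs

   Loops and multiple edges are allowed.  Every edge [e] comes with an arbitrary
   orientation, and [(e, b)] denotes [e] or its reverse: it goes from
   [ends e (~~ b)] to [ends e b]. *)

Record finite_graph := FiniteGraph {
  vert : finType;
  edge : finType;
  ends : edge -> bool -> vert }.

Section FiniteGraphs.
Variable Z : finite_graph.

Definition dorg (d : edge Z * bool) : vert Z := ends d.1 (~~ d.2).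
Definition dter (d : edge Z * bool) : vert Z := ends d.1 d.2.

Fixpoint walk (u : vert Z) (p : seq (edge Z * bool)) (v : vert Z) : bool :=
  if p is d :: p' then (dorg d == u) && walk (dter d) p' v else u == v.

Definition walk_in (T : {set edge Z}) u p v : bool :=
  all (fun d : edge Z * bool => d.1 \in T) p && walk u p v.

(* The subgraph with all the vertices and with edge set [T] is connected. *)
Definition connected_by (T : {set edge Z}) : Prop :=
  inhabited (vert Z) /\ forall u v, exists p, walk_in T u p v.

Definition finite_graph_connected : Prop := connected_by [set: edge Z]%SET.

Definition circuit (T : {set edge Z}) u p : bool :=
  [&& p != [::], walk_in T u p u, uniq (map dorg p) & uniq (map fst p)].

Definition maximal_tree (T : {set edge Z}) : Prop :=
  connected_by T /\ forall u p, ~~ circuit T u p.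

End FiniteGraphs.

(** * Graphs of topological groups and their fundamental groups *)

Record graph_of_groups (Z : finite_graph) := GraphOfGroups {
  vgroup : vert Z -> topologicalGroupType;
  egroup : edge Z -> topologicalGroupType;
  emb : forall (e : edge Z) (b : bool), egroup e -> vgroup (ends e b);
  emb_hom : forall e b, group_hom (@emb e b);
  emb_open : forall e b, open_embedding (@emb e b) }.

Inductive letter (Z : finite_graph) (GG : graph_of_groups Z) : Type :=
  | VLetter (v : vert Z) of vgroup GG v
  | ELetter of edge Z & bool.
Arguments VLetter {Z GG} v _.
Arguments ELetter {Z} GG _ _.

HB.instance Definition _ Z (GG : graph_of_groups Z) :=
  gen_eqMixin (letter GG).
HB.instance Definition _ Z (GG : graph_of_groups Z) :=
  gen_choiceMixin (letter GG).

Section FundamentalGroup.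
Variables (Z : finite_graph) (GG : graph_of_groups Z) (T : {set edge Z}).

Local Notation word := (seq (letter GG)).

(* Serre's presentation of the fundamental group relative to the maximal tree
   [T]: with t_e := ELetter e true, the relations are t_e a^e t_e^-1 = a^(ebar)
   for a in G_e, together with t_e = 1 for e in T. *)
Inductive pi1_rel : word -> word -> Prop :=
  | pi1_refl w : pi1_rel w w
  | pi1_sym w w' : pi1_rel w w' -> pi1_rel w' w
  | pi1_trans w w' w'' : pi1_rel w w' -> pi1_rel w' w'' -> pi1_rel w w''
  | pi1_cat w1 w1' w2 w2' :
      pi1_rel w1 w1' -> pi1_rel w2 w2' -> pi1_rel (w1 ++ w2) (w1' ++ w2')
  | pi1_vertex1 v : pi1_rel [:: VLetter v 1] [::]
  | pi1_vertexM v (g h : vgroup GG v) :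
      pi1_rel [:: VLetter v g; VLetter v h] [:: VLetter v (g * h)]
  | pi1_edgeV e b : pi1_rel [:: ELetter GG e b; ELetter GG e (~~ b)] [::]
  | pi1_edge e b (a : egroup GG e) :
      pi1_rel [:: ELetter GG e b; VLetter (ends e b) (emb b a);
                  ELetter GG e (~~ b)]
              [:: VLetter (ends e (~~ b)) (emb (~~ b) a)]
  | pi1_tree e b : e \in T -> pi1_rel [:: ELetter GG e b] [::].

Let pi1_relb (w w' : word) : bool := `[< pi1_rel w w' >].

Fact pi1_rel_refl : reflexive pi1_relb.
Proof. by move=> w; apply/asboolP; exact: pi1_refl. Qed.

Fact pi1_rel_sym : symmetric pi1_relb.
Proof. by move=> w w'; apply/asboolP/asboolP; exact: pi1_sym. Qed.

Fact pi1_rel_trans : transitive pi1_relb.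
Proof.
move=> w w' w'' /asboolP h /asboolP h'; apply/asboolP; exact: pi1_trans h h'.
Qed.

Definition pi1_equiv : equiv_rel word :=
  EquivRel pi1_relb pi1_rel_refl pi1_rel_sym pi1_rel_trans.

Definition pi1 : Type := {eq_quot pi1_equiv}%qT.
HB.instance Definition _ := Choice.on pi1.

Definition pi1_class (w : word) : pi1 := (\pi_{eq_quot pi1_equiv} w)%qT.

Definition letterV (l : letter GG) : letter GG :=
  match l with
  | VLetter v g => VLetter v g^-1
  | ELetter e b => ELetter GG e (~~ b)
  end.

Definition pi1_mul (x y : pi1) : pi1 := pi1_class (repr x ++ repr y).
Definition pi1_inv (x : pi1) : pi1 :=
  pi1_class (rev (map letterV (repr x))).

Lemma pi1_classP w w' : pi1_class w = pi1_class w' <-> pi1_rel w w'.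
Proof.
split=> [/eqquotP /asboolP //|h].
by apply/eqquotP/asboolP.
Qed.

Lemma pi1_classK x : pi1_class (repr x) = x.
Proof. exact: reprK. Qed.

Lemma repr_classP w : pi1_rel (repr (pi1_class w)) w.
Proof. by apply/pi1_classP; rewrite pi1_classK. Qed.

Lemma pi1_mulE w w' : pi1_mul (pi1_class w) (pi1_class w') = pi1_class (w ++ w').
Proof. by apply/pi1_classP; apply: pi1_cat; exact: repr_classP. Qed.

Lemma pi1_relVl w : pi1_rel (rev (map letterV w) ++ w) [::].
Proof.
elim: w => [|l w IHw]; first exact: pi1_refl.
rewrite /= rev_cons -cats1 -catA /= -[l :: w]cat1s.
apply: pi1_trans IHw; apply: pi1_cat; first exact: pi1_refl.
rewrite -[letterV l :: _]/([:: letterV l; l] ++ w) -[X in pi1_rel _ X]cat0s.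
apply: pi1_cat; last exact: pi1_refl.
case: l => [v g|e b] /=; last by rewrite -{2}[b]negbK; exact: pi1_edgeV.
by apply: pi1_trans (pi1_vertexM _ _) _; rewrite mulVg; exact: pi1_vertex1.
Qed.

Lemma pi1_letterVK w : pi1_rel (rev (map letterV (rev (map letterV w)))) w.
Proof.
rewrite map_rev revK -map_comp map_id_in; first exact: pi1_refl.
by case=> [v g|e b] _ /=; rewrite ?invgK ?negbK.
Qed.

Lemma pi1_relVr w : pi1_rel (w ++ rev (map letterV w)) [::].
Proof.
apply: pi1_trans (pi1_relVl (rev (map letterV w))).
by apply: pi1_cat; [apply: pi1_sym; exact: pi1_letterVK | exact: pi1_refl].
Qed.

Lemma pi1_mulA : associative pi1_mul.
Proof.
move=> x y z; rewrite -(pi1_classK x) -(pi1_classK y) -(pi1_classK z).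
by rewrite !pi1_mulE catA.
Qed.

Lemma pi1_mul1 : left_id (pi1_class [::]) pi1_mul.
Proof. by move=> x; rewrite -{1}(pi1_classK x) pi1_mulE pi1_classK. Qed.

Lemma pi1_mulr1 : right_id (pi1_class [::]) pi1_mul.
Proof. by move=> x; rewrite -{1}(pi1_classK x) pi1_mulE cats0 pi1_classK. Qed.

Lemma pi1_mulV : left_inverse (pi1_class [::]) pi1_inv pi1_mul.
Proof.
move=> x; rewrite -{2}(pi1_classK x) pi1_mulE.
by apply/pi1_classP; exact: pi1_relVl.
Qed.

Lemma pi1_mulrV : right_inverse (pi1_class [::]) pi1_inv pi1_mul.
Proof.
move=> x; rewrite -{1}(pi1_classK x) pi1_mulE.
by apply/pi1_classP; exact: pi1_relVr.
Qed.

HB.instance Definition _ := isGroup.Build pi1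
  pi1_mulA pi1_mul1 pi1_mulr1 pi1_mulV pi1_mulrV.

Definition pi1_vert (v : vert Z) (g : vgroup GG v) : pi1 :=
  pi1_class [:: VLetter v g].

(* [phi] identifies the abstract group [pi1] with the topological group [Gam],
   in such a way that the inclusions of the vertex groups are open topological
   embeddings: [Gam] is the fundamental group with its group topology. *)
Definition topological_pi1 (Gam : topologicalGroupType) (phi : pi1 -> Gam) :
    Prop :=
  [/\ group_hom phi, bijective phi &
      forall v, open_embedding (phi \o @pi1_vert v)].

End FundamentalGroup.

(* Main.v *)
Require Import Defs.
From mathcomp Require Import all_boot all_order all_algebra.
From mathcomp Require Import boolp classical_sets functions cardinality topology.
From mathcomp Require Import zify lra.

(**
  Each vertex group [G_v] acts on a fine hyperbolic Cayley-Abels graph [X_v].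
  First [X_v] is enlarged so that every compact edge group [K] at [v] fixes a
  vertex: [K] leaves invariant a finite connected subgraph, the hull, and for
  every coset [gK] one adds a vertex joined to all points of the [g]-translate of
  the hull by spokes at least as long as its diameter.  The spokes fold onto
  paths of the hull, hence [X_v] stays isometrically embedded and hyperbolicity is
  a matter of additive constants.

  Then the copies of the graphs [X_v], indexed by the cosets of [G_v] in the
  fundamental group, are joined by one edge between fixed vertices for each edge
  of the Bass-Serre tree.  These edges are bridges, so the copies are
  isometrically embedded, and fineness and the four-point condition hold in the
  glued graph because they hold in the copies.

  That an edge of the Bass-Serre tree separates it is proved without normal
  forms: Serre's presentation defines a derivation of the fundamental group with
  values in the functions to the field with two elements, and the corresponding
  potential jumps at the given edge only.

  Finally, in a fine graph with compact edge stabilizers a non-compact group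
  fixes at most one vertex, which yields both the orbit condition for parabolic
  subgroups and the fact that distinct ones are not conjugate.
*)

Set Implicit Arguments.
Unset Strict Implicit.
Unset Printing Implicit Defensive.

Local Open Scope classical_set_scope.

(** * Bounded walks, fineness and the four-point condition *)

Section Walks.
Variable T : Type.
Implicit Types (r : T -> T -> Prop) (n m : nat).

(* [bwalk r n a b]: some [r]-walk with at most [n] steps leads from [a] to [b]. *)
Inductive bwalk r : nat -> T -> T -> Prop :=
  | bwalk0 n a : bwalk r n a a
  | bwalkS n a b c : r a b -> bwalk r n b c -> bwalk r n.+1 a c.

Lemma bwalk_cat r n m a b c :
  bwalk r n a b -> bwalk r m b c -> bwalk r (n + m) a c.
Proof.
move=> w; elim: w c m => {n a b} [n a|n a b d rab _ IH] c m wbc.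
  (* A trivial walk carries an arbitrary bound [n], so this case is the weakening of the bound from
     [m] to [n + m]. *)
  elim: n => [//|n IH]; rewrite addSn; case: {wbc} IH => [k x|k x y z rxy w].
    exact: bwalk0.
  apply: bwalkS rxy _; elim: w => [k' x'|k' x' y' z' rxy' _ w']; first exact: bwalk0.
  exact: bwalkS rxy' w'.
by rewrite addSn; apply: bwalkS rab _; exact: IH.
Qed.

Lemma bwalk_mono r n m a b : (n <= m)%N -> bwalk r n a b -> bwalk r m a b.
Proof.
by move=> /subnKC <- w; rewrite addnC; exact: bwalk_cat (bwalk0 _ _ _) w.
Qed.

Lemma bwalk1 r a b : r a b -> bwalk r 1 a b.
Proof. by move=> rab; exact: bwalkS rab (bwalk0 _ _ _). Qed.

Lemma bwalk_snoc r n a b c : bwalk r n a b -> r b c -> bwalk r n.+1 a c.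
Proof. by move=> w rbc; rewrite -addn1; exact: bwalk_cat w (bwalk1 rbc). Qed.

Lemma bwalk_sym r n a b : (forall x y, r x y -> r y x) ->
  bwalk r n a b -> bwalk r n b a.
Proof.
move=> rC; elim=> {n a b} [n a|n a b c rab _ IH]; first exact: bwalk0.
exact: bwalk_snoc IH (rC _ _ rab).
Qed.

Lemma bwalk_sub r r' n a b : (forall x y, r x y -> r' x y) ->
  bwalk r n a b -> bwalk r' n a b.
Proof.
move=> rr'; elim=> {n a b} [n a|n a b c rab _ IH]; first exact: bwalk0.
exact: bwalkS (rr' _ _ rab) IH.
Qed.

Lemma bwalk_finite r n a : (forall x, finite_set [set y | r x y]) ->
  finite_set [set b | bwalk r n a b].
Proof.
move=> rfin; elim: n a => [|n IH] a.
  apply: sub_finite_set (finite_set1 a) => b /= w.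
  by inversion w.
apply: (@sub_finite_set _ _
    ([set a] `|` \bigcup_(c in [set y | r a y]) [set b | bwalk r n c b])).
  move=> b /= w; inversion w; subst; first by left.
  by right; exists b0.
rewrite finite_setU; split; first exact: finite_set1.
exact: bigcup_finite.
Qed.

End Walks.

Lemma bwalk_map (T U : Type) (f : T -> U) (r : T -> T -> Prop)
    (r' : U -> U -> Prop) n a b :
  (forall x y, r x y -> f x = f y \/ r' (f x) (f y)) ->
  bwalk r n a b -> bwalk r' n (f a) (f b).
Proof.
move=> rr'; elim=> {n a b} [n a|n a b c rab _ IH]; first exact: bwalk0.
case: (rr' _ _ rab) => [->|r'ab]; last exact: bwalkS r'ab IH.
exact: bwalk_mono IH.
Qed.

Definition off (T : Type) (x : T) (r : T -> T -> Prop) (a b : T) : Prop :=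
  [/\ r a b, a <> x & b <> x].

Definition inside (T : Type) (A : set T) (r : T -> T -> Prop) (a b : T) : Prop :=
  [/\ r a b, A a & A b].

Definition sym (T : Type) (r : T -> T -> Prop) := forall x y, r x y -> r y x.

Lemma off_sym T (x : T) r : sym r -> sym (off x r).
Proof. by move=> rC a b [/rC rba ax bx]; split. Qed.

Lemma inside_sym T (A : set T) r : sym r -> sym (inside A r).
Proof. by move=> rC a b [/rC rba ax bx]; split. Qed.

(* Bowditch's local form of fineness: the angle metric on the set of neighbours
   of [x], given by walks avoiding [x], is locally finite. *)
Definition angfine (T : Type) (r : T -> T -> Prop) : Prop :=
  forall x y n, r x y -> finite_set [set z | r x z /\ bwalk (off x r) n y z].

Definition edgeP (X : Type) (adj : rel X) (x y : X) : Prop := adj x y.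

(** The default 0 is taken when no walk joins [x] to [y]; this is why the lemmas below ask for some
    walk as evidence. *)
Definition dist (T : Type) (r : T -> T -> Prop) (x y : T) : nat :=
  xget 0 [set n | bwalk r n x y /\ forall m, bwalk r m x y -> (n <= m)%N].

Section Dist.
Variables (T : Type) (r : T -> T -> Prop).

Lemma distP n x y : bwalk r n x y ->
  bwalk r (dist r x y) x y /\ forall m, bwalk r m x y -> (dist r x y <= m)%N.
Proof.
move=> w; rewrite /dist; case: xgetP => [n' _ //|nex].
have ex : exists n, `[< bwalk r n x y >] by exists n; apply/asboolP.
case: (ex_minnP ex) => k /asboolP wk kmin.
by case: (nex k); split=> // m wm; apply: kmin; apply/asboolP.
Qed.

Lemma dist_walk n x y : bwalk r n x y -> bwalk r (dist r x y) x y.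
Proof. by move=> /distP[]. Qed.

Lemma dist_min n x y : bwalk r n x y -> (dist r x y <= n)%N.
Proof. by move=> w; case: (distP w) => _; apply. Qed.

Lemma dist_triangle n m x y z : bwalk r n x y -> bwalk r m y z ->
  (dist r x z <= dist r x y + dist r y z)%N.
Proof. by move=> /dist_walk w /dist_walk w'; exact: dist_min (bwalk_cat w w'). Qed.

Lemma dist_sym n x y : sym r -> bwalk r n x y -> dist r x y = dist r y x.
Proof.
move=> rC w; apply/eqP; rewrite eqn_leq; apply/andP; split.
  by apply: dist_min (bwalk_sym rC _); apply: dist_walk (bwalk_sym rC w).
by apply: dist_min (bwalk_sym rC _); apply: dist_walk w.
Qed.

End Dist.

(** * Edge paths of simplicial graphs as bounded walks *)

Section Paths.
Variables (X : choiceType) (adj : rel X).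

Lemma path_bwalk x p : path adj x p -> bwalk (edgeP adj) (size p) x (last x p).
Proof.
elim: p x => [|y p IH] x /=; first by move=> _; exact: bwalk0.
by case/andP=> xy /IH; exact: bwalkS.
Qed.

Lemma bwalk_path n x y : bwalk (edgeP adj) n x y ->
  exists2 p, edge_path adj x y p & (size p <= n)%N.
Proof.
elim=> {n x y} [n x|n x y z xy _ [p [yp lp] sp]]; first by exists [::].
by exists (y :: p) => //; split => //=; rewrite xy.
Qed.

Lemma graph_distE : graph_dist adj = dist (edgeP adj).
Proof.
apply/funext => x; apply/funext => y; rewrite /graph_dist /dist; congr xget.
apply/seteqP; split => n /=.
  case=> -[p [xp lp] sp] nmin; split.
    by have := path_bwalk xp; rewrite lp sp.
  by move=> m /bwalk_path[q /nmin nq]; exact: leq_trans.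
case=> /bwalk_path[p xyp sp] nmin.
have nle q : edge_path adj x y q -> (n <= size q)%N.
  by case=> xq lq; apply: nmin; have := path_bwalk xq; rewrite lq.
split=> //; exists p => //; apply/eqP; rewrite eqn_leq sp; exact: nle.
Qed.

Lemma graph_connectedP : graph_connected adj <->
  inhabited X /\ forall x y, exists n, bwalk (edgeP adj) n x y.
Proof.
split=> -[X0 conn]; split=> // x y; have [u] := conn x y.
  by case=> xu lu; exists (size u); have := path_bwalk xu; rewrite lu.
by case/bwalk_path => p; exists p.
Qed.

Lemma path_off x y p : path adj y p -> x \notin y :: p ->
  bwalk (off x (edgeP adj)) (size p) y (last y p).
Proof.
elim: p y => [|z p IH] y /=; first by move=> _ _; exact: bwalk0.
case/andP=> yz zp; rewrite in_cons negb_or => /andP[xy xp].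
apply: bwalkS (IH _ zp xp); split=> //; first by apply/eqP; rewrite eq_sym.
by move: xp; rewrite in_cons negb_or => /andP[xz _]; apply/eqP; rewrite eq_sym.
Qed.

Lemma off_path n x y z : bwalk (off x (edgeP adj)) n y z -> y <> x ->
  exists p, [/\ edge_path adj y z p, x \notin y :: p & (size p <= n)%N].
Proof.
elim=> {n y z} [n y yx|n y z t [yz yx zx] _ IH _].
  by exists [::]; split=> //; rewrite inE; apply/eqP => /esym.
have [p [[zp lp] xp sp]] := IH zx; exists (z :: p); split=> //.
  by split=> //=; rewrite yz.
by rewrite in_cons negb_or xp andbT; apply/eqP => /esym.
Qed.

(** A walk from [y] to [z] off [x] shortens to an embedded path, which the edge from [z] to [x]
    prolongs to an embedded path from [y] to [x]. Fineness leaves finitely many of these, and [z] is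
    the last vertex but one. *)
Lemma fine_angfine : simplicial adj -> fine adj -> angfine (edgeP adj).
Proof.
move=> [aC aI] fin x y n xy.
(* [last y (belast y p)] is the last vertex but one of [y :: p]. *)
apply: (@sub_finite_set _ _ (\bigcup_(m in `I_n.+1)
   ((fun p => last y (belast y p)) @`
    [set p | [/\ edge_path adj y x p, uniq (y :: p) & size p = m.+1]]))).
  move=> z [xz w].
  have yx : y <> x by move=> yx; move: xy; rewrite /edgeP yx aI.
  have [p [[yp lp] xp sp]] := off_path w yx.
  case/shortenP: yp lp xp sp => q yq uq sq lq xp sp.
  have sq' : (size q <= n)%N.
    apply: leq_trans sp; apply: uniq_leq_size; first by case/andP: uq.
    exact: sq.
  have xq : x \notin y :: q.
    by apply: contra xp; rewrite !in_cons => /orP[->//|/sq ->]; rewrite orbT.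
  exists (size q) => //=; exists (rcons q x); last first.
    by rewrite belast_rcons /= lq.
  split; last by rewrite size_rcons.
    split; last by rewrite last_rcons.
    by rewrite rcons_path yq lq aC.
  by change (uniq (rcons (y :: q) x)); rewrite rcons_uniq xq.
apply: bigcup_finite; first exact: finite_II.
by move=> m _; apply: finite_image; exact: fin.
Qed.

(** Induction on the length. Fix one embedded path from [u] to [v], with second vertex [q]. The
    second vertex [z] of any other one is reached from [q] by going to [v] along the first path and
    back along the other, always off [u]; hence there are finitely many [z]. *)
Lemma angfine_fine : simplicial adj -> angfine (edgeP adj) -> fine adj.
Proof.
move=> [aC aI] fin u v n; elim: n u => [|n IH] u.
  apply: sub_finite_set (finite_set1 [::]) => p [_ _] /eqP.
  by rewrite size_eq0 => /eqP.
set P := [set p | _].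
have [->|/set0P[p0]] := eqVneq P set0; first exact: finite_set0.
case: p0 => [|q p0] [[up0 lp0] uq sp0] //=.
case/andP: (up0) => uq0 qp0; case: sp0 => sp0.
apply: (@sub_finite_set _ _ (\bigcup_(z in
    [set z | adj u z /\ bwalk (off u (edgeP adj)) (n + n) q z])
    (cons z @` [set p | [/\ edge_path adj z v p, uniq (z :: p) & size p = n]]))).
  case=> [|z p] [[up lp] up' sp] //; case/andP: (up) => uz zp.
  case: sp => sp.
  exists z; last first.
    exists p => //; split=> //; by case/andP: up'.
  split=> //; apply: (@bwalk_cat _ _ _ _ _ v).
    rewrite -sp0 -lp0; apply: path_off => //; by case/andP: uq.
  apply: bwalk_sym.
    by apply: off_sym => a b; rewrite /edgeP aC.
  rewrite -sp -lp; apply: path_off => //; by case/andP: up'.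
by apply: bigcup_finite; [exact: fin|move=> z _; apply: finite_image; exact: IH].
Qed.

End Paths.

(* The four-point condition, with [N] twice the hyperbolicity constant. *)
Definition fourpt (T : Type) (d : T -> T -> nat) (N : nat) : Prop :=
  forall w x y z,
    (d x z + d y w <= maxn (d x y + d z w) (d y z + d x w) + N)%N.

Section Hyp.
Import Order.TTheory GRing.Theory Num.Theory.
Local Open Scope ring_scope.

(** Subtracting the doubled inequality of Gromov products from the sum of the distances of [x], [y],
    [z] to [w] turns the minimum into the maximum of the four-point condition. *)
Lemma hyperbolic_fourpt (X : choiceType) (adj : rel X) :
  gromov_hyperbolic adj <-> exists N, fourpt (graph_dist adj) N.
Proof.
rewrite /gromov_hyperbolic /gromov_product.
split=> [[delta hyp]|[N four]].
  (* Distances are natural numbers, so twice [delta] is rounded up to an integer. *)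
  have [N HN] : exists N : nat, 2%:R * delta <= N%:R.
    by exists (Num.truncn (2%:R * delta)).+1; apply/ltW/truncnS_gt.
  exists N => w x y z; have := hyp w x y z.
  move: (graph_dist adj x w) (graph_dist adj y w) (graph_dist adj z w) => a b c.
  move: (graph_dist adj x y) (graph_dist adj y z) (graph_dist adj x z) => d e f.
  rewrite -(ler_nat rat) !natrD -maxEnat natr_max !natrD => h.
  move: h HN.
  case: (leP (a%:R + b%:R - d%:R) (b%:R + c%:R - e%:R : rat)) => h0;
  case: (leP (d%:R + c%:R) (e%:R + a%:R : rat)) => h1;
  case: (leP ((a%:R + b%:R - d%:R) / 2) ((b%:R + c%:R - e%:R) / 2: rat)) => h2; lra.
exists N%:R => w x y z; have := four w x y z.
move: (graph_dist adj x w) (graph_dist adj y w) (graph_dist adj z w) => a b c.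
move: (graph_dist adj x y) (graph_dist adj y z) (graph_dist adj x z) => d e f.
rewrite -(ler_nat rat) !natrD -maxEnat natr_max !natrD => h.
have := ler0n rat N.
move: h.
case: (leP (d%:R + c%:R) (e%:R + a%:R : rat)) => h1;
  case: (leP ((a%:R + b%:R - d%:R) / 2) ((b%:R + c%:R - e%:R) / 2: rat)) => h2; lra.
Qed.

End Hyp.

(** * Pieces joined by bridges *)

Section TreeOfPieces.
Variables (V : Type) (pr br : V -> V -> Prop).

Definition join_rel (x y : V) : Prop := pr x y \/ br x y.

(* [sg] witnesses that the edge [s -- s'] is a bridge of the joined graph. *)
Definition side (s s' : V) (sg : V -> bool) : Prop :=
  sg s <> sg s' /\ forall x y, join_rel x y -> sg x <> sg y ->
    (x = s /\ y = s') \/ (x = s' /\ y = s).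

Hypotheses (prC : sym pr) (brC : sym br).
Hypothesis pr_br : forall x y, pr x y -> ~ br x y.
Hypothesis bridge : forall s s', br s s' -> exists sg, side s s' sg.

Lemma join_sym : sym join_rel.
Proof. by move=> x y [/prC|/brC]; [left|right]. Qed.

Lemma side_pr s s' sg x y : br s s' -> side s s' sg -> pr x y -> sg x = sg y.
Proof.
move=> bs [_ sgP] xy; apply: contrapT => nxy.
by case: (sgP x y (or_introl xy) nxy) => -[xE yE]; subst;
  [exact: pr_br xy bs|exact: pr_br (prC xy) bs].
Qed.

Lemma side_bwalk s s' sg n x y : br s s' -> side s s' sg ->
  bwalk pr n x y -> sg x = sg y.
Proof.
move=> bs sgP; elim=> // {n x y} n x y z xy _ <-.
exact: side_pr bs sgP xy.
Qed.

(** The walk is cut at its first step between the two sides, which can only run over the bridge. *)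
Lemma side_cross (r : V -> V -> Prop) s s' sg n x y :
  (forall a b, r a b -> join_rel a b) -> side s s' sg ->
  bwalk r n x y -> sg x <> sg y ->
  exists s1 s2 k m, [/\ (s1 = s /\ s2 = s') \/ (s1 = s' /\ s2 = s),
    sg s1 = sg x, r s1 s2, bwalk r k x s1 & bwalk r m s2 y /\ (k + m < n)%N].
Proof.
move=> rj sgP; elim=> {n x y} [n x|n x z y xz zy IH] xy //.
have [xzE|xz'] := pselect (sg x = sg z).
  have [|s1 [s2 [k [m [sE s1z rs ks [ms km]]]]]] := IH; first by rewrite -xzE.
  exists s1, s2, k.+1, m; split; rewrite ?s1z ?xzE //.
  exact: bwalkS xz ks.
have [_ sg2] := sgP; have sE := sg2 _ _ (rj _ _ xz) xz'.
by exists x, z, 0, n; split=> //; exact: bwalk0.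
Qed.

(** A walk that leaves the piece over a bridge has to come back over the same bridge, so the
    excursion can be cut out. A general [r] is allowed in order to treat walks off a vertex as
    well. *)
Lemma piece_bwalk (r : V -> V -> Prop) n x y k :
  (forall a b, r a b -> join_rel a b) ->
  bwalk pr k x y -> bwalk r n x y ->
  bwalk (fun a b => r a b /\ pr a b) n x y.
Proof.
move=> rj; elim/ltn_ind: n x k => n IH x k xy w.
inversion w; subst; first exact: bwalk0.
have [xb|xb] := rj _ _ H.
  apply: bwalkS (conj H xb) _.
  by apply: IH (bwalkS (prC xb) xy) H0.
have [sg sgP] := bridge xb.
have xyE := side_bwalk xb sgP xy.
have [|s1 [s2 [j [m [sE s1b rs js [ms jm]]]]]] := side_cross rj sgP H0.
  by rewrite -xyE; apply/nesym; exact: sgP.1.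
have s2x : s2 = x.
  case: sE => -[s1E s2E]; subst => //.
  by case: sgP.1.
subst s2; apply: (@bwalk_mono _ _ m); first by lia.
by apply: IH xy ms; lia.
Qed.

Lemma piece_dist k x y : bwalk pr k x y -> dist join_rel x y = dist pr x y.
Proof.
move=> xy; have w : bwalk join_rel k x y by apply: bwalk_sub xy; left.
apply/eqP; rewrite eqn_leq; apply/andP; split.
  by apply: dist_min; apply: bwalk_sub (dist_walk xy); left.
apply: dist_min.
apply: bwalk_sub (piece_bwalk (fun _ _ h => h) xy (dist_walk w)) => a b [] //.
Qed.

(** A walk off [x] cannot run over a bridge at [x], so a bridge at [x] forms a bounded angle with
    itself only. Between two piece edges, [piece_bwalk] brings the walk back into the piece. *)
Lemma join_angfine : angfine pr -> angfine join_rel.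
Proof.
move=> fin x y n xy.
have offj a b : off x join_rel a b -> join_rel a b by case.
case: xy => xy; last first.
  apply: sub_finite_set (finite_set1 y) => z [xz w] /=.
  have [sg sgP] := bridge xy.
  apply: contrapT => zy.
  have xzE : sg x = sg z.
    apply: contrapT => /(sgP.2 _ _ xz) [[_ zE]|[xE _]] //.
    by have := sgP.1; rewrite -xE.
  have [|s1 [s2 [k [m [sE _ [_ s1x s2x] _ _]]]]] := side_cross offj sgP w.
    by rewrite -xzE; apply/nesym; exact: sgP.1.
  by case: sE => -[s1E s2E]; subst.
apply: sub_finite_set (fin x y n xy) => z /= [[xz|xz] w]; last first.
  have [sg sgP] := bridge xz.
  have xyE := side_pr xz sgP xy.
  have [|s1 [s2 [k [m [sE _ [_ s1x s2x] _ _]]]]] := side_cross offj sgP w.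
    by rewrite -xyE; exact: sgP.1.
  by case: sE => -[s1E s2E]; subst.
split=> //.
have yz : bwalk pr 2 y z by apply: bwalkS (prC xy) (bwalk1 xz).
by apply: bwalk_sub (piece_bwalk offj yz w) => a b [[_ ax bx] ab]; split.
Qed.

(** If the first step is a bridge that does not separate [x] from [y], the walk returns to [x] over
    it, and the rest of the walk is shorter. *)
Lemma separating_bridge n x y : bwalk join_rel n x y ->
  (exists k, bwalk pr k x y) \/
  exists s s' sg, [/\ br s s', side s s' sg & sg x <> sg y].
Proof.
elim/ltn_ind: n x => n IH x w; inversion w; subst.
  by left; exists 0; exact: bwalk0.
case: H => xb.
  case: (IH _ _ _ H0) => // [[k kw]|[s [s' [sg [bs sgP by']]]]].
    by left; exists k.+1; exact: bwalkS kw.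
  by right; exists s, s', sg; split; rewrite // (side_pr bs sgP xb).
have [sg sgP] := bridge xb.
have [xyE|] := pselect (sg x = sg y); last by right; exists x, b, sg.
have [|s1 [s2 [j [m [sE s1b rs js [ms jm]]]]]] :=
    side_cross (fun _ _ h => h) sgP H0.
  by rewrite -xyE; apply/nesym; exact: sgP.1.
have s2x : s2 = x.
  case: sE => -[s1E s2E]; subst => //.
  by case: sgP.1.
subst s2; apply: IH ms; lia.
Qed.

Hypothesis conn : forall x y, exists n, bwalk join_rel n x y.

Let d := dist join_rel.

Let dC x y : d x y = d y x.
Proof. by have [n w] := conn x y; exact: dist_sym join_sym w. Qed.

Let d_tri x y z : (d x z <= d x y + d y z)%N.
Proof.
by have [n w] := conn x y; have [m w'] := conn y z; exact: dist_triangle w w'.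
Qed.

(** Here [c b] is the endpoint of the bridge on the side [b]; a geodesic from one side to the other
    passes through both endpoints. *)
Lemma bridge_dist s s' sg : br s s' -> side s s' sg ->
  exists c : bool -> V, (forall b, sg (c b) = b) /\
    forall x y, sg x <> sg y ->
      d x y = (d x (c (sg x)) + 1 + d y (c (sg y)))%N.
Proof.
move=> bs sgP; exists (fun b => if b == sg s then s else s').
have [ss' sg2] := sgP; split.
  by move=> b; case: ifP => /eqP; move: ss'; case: b; case: (sg s); case: (sg s').
move=> x y xy; apply/eqP; rewrite eqn_leq; apply/andP; split.
  have cc : join_rel (if sg x == sg s then s else s') (if sg y == sg s then s else s').
    move: xy ss'; case: (sg x); case: (sg y); case: (sg s); case: (sg s') => //= _ _;
      by right => //; exact: brC.
  have [n w] := conn x (if sg x == sg s then s else s').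
  have [m w'] := conn y (if sg y == sg s then s else s').
  apply: dist_min; apply: bwalk_cat (bwalk_sym join_sym (dist_walk w')).
  exact: bwalk_cat (dist_walk w) (bwalk1 cc).
have [n w] := conn x y.
have [|s1 [s2 [j [m [sE s1x rs js [ms jm]]]]]] :=
  side_cross (fun _ _ h => h) sgP (dist_walk w); first exact: xy.
have [s1E s2E] : s1 = (if sg x == sg s then s else s') /\
    s2 = (if sg y == sg s then s else s').
  case: sE => -[s1E s2E]; rewrite s1E s2E in s1x *; move: s1x xy ss';
    by case: (sg x); case: (sg y); case: (sg s); case: (sg s').
rewrite -s1E -s2E; have := dist_min js; have := dist_min ms.
by rewrite (dC y s2) -/d; move: jm; rewrite -/d; lia.
Qed.

(* If the four points do not lie in one piece, a bridge separates them: for a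
   2-2 partition the inequality is immediate, and an isolated point can be moved
   across the bridge, which decreases the sum of the distances. *)
Lemma join_fourpt N :
  (forall w x y z k1 k2 k3, bwalk pr k1 w x -> bwalk pr k2 w y -> bwalk pr k3 w z ->
    (dist pr x z + dist pr y w <=
     maxn (dist pr x y + dist pr z w) (dist pr y z + dist pr x w) + N)%N) ->
  fourpt d N.
Proof.
move=> four w x y z.
have [n] := ubnP (d w x + d w y + d w z + d x y + d x z + d y z)%N.
elim: n w x y z => // n IH w x y z sum.
have same : (exists k, bwalk pr k w x) -> (exists k, bwalk pr k w y) ->
    (exists k, bwalk pr k w z) ->
    (d x z + d y w <= maxn (d x y + d z w) (d y z + d x w) + N)%N.
  move=> [k1 w1] [k2 w2] [k3 w3].
  have prw k a b : bwalk pr k a b -> bwalk pr k b a by exact: bwalk_sym prC.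
  rewrite /d (piece_dist (bwalk_cat (prw _ _ _ w1) w3)).
  rewrite (piece_dist (prw _ _ _ w2)) (piece_dist (bwalk_cat (prw _ _ _ w1) w2)).
  rewrite (piece_dist (prw _ _ _ w3)) (piece_dist (bwalk_cat (prw _ _ _ w2) w3)).
  by rewrite (piece_dist (prw _ _ _ w1)); exact: four w1 w2 w3.
have split s s' sg : br s s' -> side s s' sg ->
    [|| sg w != sg x, sg w != sg y | sg w != sg z] ->
    (d x z + d y w <= maxn (d x y + d z w) (d y z + d x w) + N)%N.
  move=> bs sgP nsg.
  have [c [cE cd]] := bridge_dist bs sgP.
  pose f p := d p (c (sg p)).
  (* Here [p] is alone on its side. Moving it to the far endpoint of the bridge lowers its distances
     to [q], [t], [u] by [f p + 1] each. Each of the three sums in the four-point condition contains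
     exactly one of them, so the inequality is unaffected. *)
  have lone p q t u : sg p <> sg q -> sg p <> sg t -> sg p <> sg u ->
      (d p q + d p t + d p u + d q t + d q u + d t u < n.+1)%N ->
      (d q u + d t p <= maxn (d q t + d u p) (d t u + d q p) + N)%N.
    move=> pq pt pu; have := IH (c (~~ sg p)) q t u.
    have cp a : sg p <> sg a -> d a (c (~~ sg p)) = f a /\ d p a = (f p + 1 + f a)%N.
      move=> pa; split; last exact: cd.
      by rewrite /f; congr (d _ (c _)); move: pa; case: (sg p); case: (sg a).
    rewrite (dC (c _) q) (dC (c _) t) (dC (c _) u) (dC t p) (dC u p) (dC q p).
    have [-> ->] := cp _ pq; have [-> ->] := cp _ pt; have [-> ->] := cp _ pu.
    clear; lia.
  (* The two sums of distances across the bridge agree and bound the sum of the distances within the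
     sides. *)
  have pair p q t u : sg p = sg q -> sg t = sg u -> sg p <> sg t ->
      (d p q + d t u <= d p t + d q u)%N /\ (d p t + d q u = d p u + d q t)%N.
    move=> pq tu pt.
    have pqf : (d p q <= f p + f q)%N.
      by rewrite /f (dC q) -pq; exact: d_tri.
    have tuf : (d t u <= f t + f u)%N.
      by rewrite /f (dC u) -tu; exact: d_tri.
    have qt : sg q <> sg t by rewrite -pq.
    have := cd _ _ pt; have := cd p u; have := cd q u; have := cd _ _ qt.
    rewrite -tu => /[swap] /(_ qt) + /[swap] /(_ pt); rewrite -/(f p) -/(f t).
    have -> : d u (c (sg t)) = f u by rewrite /f tu.
    rewrite -/(f q); move: pqf tuf; clear; lia.
  have xw := dC x w; have yw := dC y w; have zw := dC z w.
  have yx := dC y x; have zx := dC z x; have zy := dC z y.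
  have nb (a b e : bool) : a <> b -> a <> e -> b = e by case: a b e => [] [] [].
  have [wx|/eqP wx] := eqVneq (sg w) (sg x);
    have [wy|/eqP wy] := eqVneq (sg w) (sg y);
    have [wz|/eqP wz] := eqVneq (sg w) (sg z).
  - by move: nsg; rewrite -wx -wy -wz !eqxx.
  - have := @lone z w x y; rewrite -wx -wy.
    by move=> /(_ (nesym wz) (nesym wz) (nesym wz)); move: sum; clear -xw yw zw yx zx zy; lia.
  - have := @lone y z w x; rewrite -wx -wz.
    by move=> /(_ (nesym wy) (nesym wy) (nesym wy)); move: sum; clear -xw yw zw yx zx zy; lia.
  - have [] := @pair w x y z wx (nb _ _ _ wy wz) wy; clear -xw yw zw yx zx zy; lia.
  - have := @lone x y z w; rewrite -wy -wz.
    by move=> /(_ (nesym wx) (nesym wx) (nesym wx)); move: sum; clear -xw yw zw yx zx zy; lia.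
  - have [] := @pair w y x z wy (nb _ _ _ wx wz) wx; clear -xw yw zw yx zx zy; lia.
  - have [] := @pair w z x y wz (nb _ _ _ wx wy) wx; clear -xw yw zw yx zx zy; lia.
  - by have := @lone w x y z wx wy wz; apply.
have [n1 w1] := conn w x; have [n2 w2] := conn w y; have [n3 w3] := conn w z.
case: (separating_bridge w1) => [h1|[s [s' [sg [bs sgP ne]]]]]; last first.
  by apply: split bs sgP _; apply/orP; left; apply/eqP.
case: (separating_bridge w2) => [h2|[s [s' [sg [bs sgP ne]]]]]; last first.
  by apply: split bs sgP _; apply/orP; right; apply/orP; left; apply/eqP.
case: (separating_bridge w3) => [h3|[s [s' [sg [bs sgP ne]]]]]; last first.
  by apply: split bs sgP _; apply/orP; right; apply/orP; right; apply/eqP.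
exact: same.
Qed.

End TreeOfPieces.

(** * Attaching stars to hulls *)

(** With pauses allowed, a walk of bound [n] takes exactly [n] steps, as is required for folding a
    spoke of fixed length onto it. *)
Lemma bwalk_fun (T : Type) (r : T -> T -> Prop) n a b : bwalk r n a b ->
  exists f : nat -> T, [/\ f 0 = a, f n = b &
    forall i, f i = f i.+1 \/ r (f i) (f i.+1)].
Proof.
elim=> {n a b} [n a|n a b c ab _ [f [f0 fn fS]]].
  by exists (fun=> a); split=> // i; left.
exists (fun i => if i is j.+1 then f j else a); split=> // -[|i] //=.
by right; rewrite f0.
Qed.

Section Stars.
Variables (X C : choiceType) (r : X -> X -> Prop) (hull : C -> set X) (L : nat).

(** Only interior points of spokes are listed: their ends are points of [X] and centres, which
    several spokes share. *)
Definition leg : choiceType :=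
  {q : C * X * nat | `[< hull q.1.1 q.1.2 >] && (0 < q.2 < L)}.

Definition star_graph : choiceType := (X + C + leg)%type.

Definition vX (x : X) : star_graph := inl (inl x).
Definition ctr (c : C) : star_graph := inl (inr c).

(* The [i]-th point of the spoke of length [L] from [s] to the centre [c], which
   is [s] for [i = 0] and [c] for [i = L]; it is [c] if [i > L] or if [0 < i] and
   [s] is not in the hull of [c]. *)
Definition lp (c : C) (s : X) (i : nat) : star_graph :=
  if i == 0 then vX s else if insub (c, s, i) is Some q then inr q else ctr c.

Definition star (p : star_graph) : option C :=
  match p with
  | inl (inl _) => None | inl (inr c) => Some c | inr q => Some (val q).1.1
  end.

Definition level (p : star_graph) : nat :=
  match p with inl (inl _) => 0 | inl (inr c) => L | inr q => (val q).2 end.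

Definition spoke (p q : star_graph) : Prop :=
  exists c s i, [/\ hull c s, (i < L)%N, p = lp c s i & q = lp c s i.+1].

Definition star_rel (p q : star_graph) : Prop :=
  [\/ exists x y, [/\ p = vX x, q = vX y & r x y], spoke p q | spoke q p].

Hypotheses (rC : sym r) (L_gt0 : (0 < L)%N).
Hypothesis hull_neq0 : forall c, hull c !=set0.
Hypothesis hull_finite : forall c, finite_set (hull c).
Hypothesis hull_conn : forall c s t, hull c s -> hull c t ->
  bwalk (inside (hull c) r) L s t.
Hypothesis hull_edge : forall x y, r x y ->
  finite_set [set c | hull c x /\ hull c y].

Lemma star_rel_sym : sym star_rel.
Proof.
move=> p q [[x [y [-> -> /rC xy]]]|pq|qp].
- by apply: Or31; exists y, x.
- exact: Or33.
- exact: Or32.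
Qed.

Lemma lp0 c s : lp c s 0 = vX s. Proof. by []. Qed.

Lemma lpL c s : lp c s L = ctr c.
Proof. by rewrite /lp gtn_eqF // insubN //= ltnn !andbF. Qed.

Lemma lp_leg c s i (h : `[< hull c s >] && (0 < i < L)) :
  lp c s i = inr (exist _ (c, s, i) h).
Proof.
have := h => /andP[_ /andP[i0 _]].
rewrite /lp gtn_eqF //; case: insubP => [q _ qE|]; last by rewrite h.
by congr inr; apply: val_inj.
Qed.

Lemma star_lp c s i : (0 < i)%N -> star (lp c s i) = Some c.
Proof.
move=> i0; rewrite /lp gtn_eqF //.
by case: insubP => [q _ /= ->|].
Qed.

Lemma level_lp c s i : hull c s -> (i <= L)%N -> level (lp c s i) = i.
Proof.
move=> hs; case: (posnP i) => [->//|i0].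
rewrite leq_eqVlt => /orP[/eqP->|iL]; first by rewrite lpL.
have h : `[< hull c s >] && (0 < i < L) by rewrite i0 iL !andbT; apply/asboolP.
by rewrite (lp_leg h).
Qed.

(** A centre is the end of any of its spokes, and there is one because hulls are non-empty. Thus all
    new points can be treated uniformly as [lp c s i] with [0 < i]. *)
Lemma star_graphP p : (exists x, p = vX x) \/
  exists c s i, [/\ hull c s, (0 < i <= L)%N & p = lp c s i].
Proof.
case: p => [[x|c]|[[[c s] i] h]]; first by left; exists x.
  right; have [s hs] := hull_neq0 c; exists c, s, L.
  by rewrite lpL leqnn L_gt0.
right; exists c, s, i; rewrite -(lp_leg h).
by case/andP: (h) => /asboolP /= hs /andP[-> /ltnW ->].
Qed.

Lemma lp_vX c s i x : lp c s i = vX x -> i = 0 /\ s = x.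
Proof.
case: (posnP i) => [->|i0]; first by rewrite lp0 => -[].
by move=> /(congr1 star); rewrite star_lp.
Qed.

Lemma star_relX x z : star_rel (vX x) z ->
  (exists2 y, r x y & z = vX y) \/ exists2 c, hull c x & z = lp c x 1.
Proof.
case=> [[a [b [[->] -> ab]]]|[c [s [i [hs iL /esym pE ->]]]]|[c [s [i [hs iL _ /esym pE]]]]].
- by left; exists b.
- by have [iE sE] := lp_vX pE; subst; right; exists c.
- by have [] := lp_vX pE.
Qed.

Lemma star_rel_lp c s i z : hull c s -> (0 < i)%N -> star_rel (lp c s i) z ->
  exists t j, [/\ hull c t, (j <= L)%N & z = lp c t j].
Proof.
move=> hs i0 [[a [b [pE _ _]]]|[c' [t [j [ht jL pE ->]]]]|[c' [t [j [ht jL -> pE]]]]].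
- by have [iE _] := lp_vX pE; rewrite iE in i0.
- have := congr1 star pE; rewrite star_lp //; case: (posnP j) => [->//|j0].
  by rewrite star_lp // => -[->]; exists t, j.+1.
- have := congr1 star pE; rewrite !star_lp // => -[->].
  by exists t, j; split=> //; exact: ltnW.
Qed.

Lemma spoke_walk c s i : hull c s -> (i <= L)%N ->
  bwalk star_rel i (vX s) (lp c s i).
Proof.
move=> hs; elim: i => [_|i IH iL]; first by rewrite lp0; exact: bwalk0.
apply: bwalk_snoc (IH (ltnW iL)) _.
by apply: Or32; exists c, s, i.
Qed.

Lemma star_rel_vX x y : r x y -> star_rel (vX x) (vX y).
Proof. by move=> xy; apply: Or31; exists x, y. Qed.

Lemma vX_walk n x y : bwalk r n x y -> bwalk star_rel n (vX x) (vX y).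
Proof. by apply: bwalk_map => a b ab; right; exact: star_rel_vX. Qed.

(* As the spokes are as long as the diameter of the hull, they can be folded
   onto paths of the hull that lead to a base point. *)
Lemma retraction : exists ret : star_graph -> X,
  [/\ forall x, ret (vX x) = x,
      forall p q, star_rel p q -> ret p = ret q \/ r (ret p) (ret q) &
      forall p, bwalk star_rel (L + L) p (vX (ret p))].
Proof.
have [base baseP] := @choice _ _ (fun c s => hull c s) hull_neq0.
have paths (q : C * X) : exists g : nat -> X, hull q.1 q.2 ->
    [/\ g 0 = q.2, g L = base q.1 &
      forall i, g i = g i.+1 \/ inside (hull q.1) r (g i) (g i.+1)].
  case: q => c s /=; have [hs|nhs] := pselect (hull c s).
    by have [g gP] := bwalk_fun (hull_conn hs (baseP c)); exists g.
  by exists (fun=> s).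
have [f fP] := choice paths.
pose ret (p : star_graph) : X := match p with
  | inl (inl x) => x | inl (inr c) => base c
  | inr q => f ((val q).1.1, (val q).1.2) (val q).2 end.
have retE c s i : hull c s -> (i <= L)%N -> ret (lp c s i) = f (c, s) i.
  move=> hs; have [/= f0 fL _] := fP (c, s) hs.
  case: (posnP i) => [->|i0]; first by rewrite lp0 f0.
  rewrite leq_eqVlt => /orP[/eqP->|iL]; first by rewrite lpL fL.
  have h : `[< hull c s >] && (0 < i < L) by rewrite i0 iL !andbT; apply/asboolP.
  by rewrite (lp_leg h).
have retS p q : spoke p q -> ret p = ret q \/ r (ret p) (ret q).
  move=> [c [s [i [hs iL -> ->]]]]; rewrite !retE //; last exact: ltnW.
  have [_ _ /(_ i)[->|[]]] := fP (c, s) hs; by [left|right].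
exists ret; split=> //.
  move=> p q [[x [y [-> -> xy]]]|/retS//|/retS]; first by right.
  by case=> [->|/rC]; [left|right].
move=> p; case: (star_graphP p) => [[x ->]|[c [s [i [hs /andP[_ iL] ->]]]]].
  exact: bwalk0.
(* From [p] back along the spoke to [s], then along the path onto which this spoke is folded: at
   most [L] steps each. *)
rewrite retE //; have [f0 _ fS] := fP (c, s) hs.
apply: (@bwalk_cat _ _ _ _ _ (vX s)).
  by apply: (bwalk_mono iL); apply: (bwalk_sym star_rel_sym); exact: spoke_walk.
apply: vX_walk; apply: (bwalk_mono iL); rewrite -[X in bwalk _ _ X]f0.
elim: i {iL} => [|i IH]; first exact: bwalk0.
have [<-|[fr _ _]] := fS i; first exact: bwalk_mono IH.
exact: bwalk_snoc IH fr.
Qed.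

Hypothesis conn : forall x y, exists n, bwalk r n x y.

Lemma star_conn p q : exists n, bwalk star_rel n p q.
Proof.
have [ret [_ _ retW]] := retraction.
have [n w] := conn (ret p) (ret q).
exists (L + L + (n + (L + L))); apply: bwalk_cat (retW p) _.
exact: bwalk_cat (vX_walk w) (bwalk_sym star_rel_sym (retW q)).
Qed.

(** The retraction does not increase distances and moves points by at most [2 * L], so it changes a
    distance by at most [4 * L] and a sum of two by at most [8 * L]. *)
Lemma star_fourpt N : fourpt (dist r) N ->
  exists N', fourpt (dist star_rel) N'.
Proof.
have [ret [retX retS retW]] := retraction.
have key p q : (dist r (ret p) (ret q) <= dist star_rel p q <=
    dist r (ret p) (ret q) + 4 * L)%N.
  have [n w] := star_conn p q; have [m w'] := conn (ret p) (ret q).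
  apply/andP; split; first exact: dist_min (bwalk_map retS (dist_walk w)).
  have -> : (dist r (ret p) (ret q) + 4 * L =
    L + L + (dist r (ret p) (ret q) + (L + L)))%N by lia.
  apply: dist_min; apply: bwalk_cat (retW p) _.
  exact: bwalk_cat (vX_walk (dist_walk w')) (bwalk_sym star_rel_sym (retW q)).
move=> four; exists (N + 8 * L) => w x y z.
have := four (ret w) (ret x) (ret y) (ret z).
have /andP[_] := key x z; have /andP[_] := key y w.
have /andP[+ _] := key x y; have /andP[+ _] := key z w.
have /andP[+ _] := key y z; have /andP[+ _] := key x w.
clear; lia.
Qed.

(** Follow a walk in the hull from [a] to [x] and stop just before it first meets [x]. *)
Lemma hull_exit c x a : hull c x -> hull c a -> a <> x ->
  exists y, [/\ hull c y, r x y & bwalk (off x r) L a y].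
Proof.
move=> hx ha; elim: (hull_conn ha hx) => {a ha} [n a //|n a b c' [ab ha hb] _ IH] ac.
have [bE|bc] := pselect (b = c').
  subst; exists a; split=> //; [exact: rC|exact: bwalk0].
by have [y [hy cy w]] := IH bc; exists y; split=> //; exact: bwalkS w.
Qed.

Section AngleAtX.
Variable x : X.

(* [near j y p]: the germ [y] at [x] is at distance at most [j] from [p], or
   from the hull of [c] if [p] lies in the star of [c], unless this hull
   contains [x], in which case [y] is the spoke from [x] to [c]. *)
Definition near (j : nat) (y p : star_graph) : Prop :=
  [\/ exists y' a, [/\ y = vX y', p = vX a, r x y' & bwalk (off x r) j y' a],
      exists c h y', [/\ star p = Some c, ~ hull c x, hull c h,
        y = vX y' & r x y' /\ bwalk (off x r) j y' h] |
      exists c, [/\ star p = Some c, hull c x & y = lp c x 1]].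

(** The moves of a germ at [x] while a walk off [x] proceeds: between two edges of the base graph at
    angle at most [m], or between the spoke to [c] and an edge from [x] to another point of the hull
    of [c]. *)
Definition germ_rel (m : nat) (y z : star_graph) : Prop :=
  [\/ exists y' z', [/\ y = vX y', z = vX z', r x y', r x z' & bwalk (off x r) m y' z'],
      exists c y', [/\ y = lp c x 1, z = vX y', hull c x, hull c y' & r x y'] |
      exists c y', [/\ z = lp c x 1, y = vX y', hull c x, hull c y' & r x y']].

Lemma near_mono j k y p : (j <= k)%N -> near j y p -> near k y p.
Proof.
move=> jk [[y' [a [-> -> xy w]]]|[c [h [y' [pc nc hh -> [xy w]]]]]|h]; last exact: Or33.
  by apply: Or31; exists y', a; split=> //; exact: bwalk_mono w.
by apply: Or32; exists c, h, y'; split=> //; split=> //; exact: bwalk_mono w.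
Qed.

Lemma germ_rel_mono j k y p : (j <= k)%N -> germ_rel j y p -> germ_rel k y p.
Proof.
move=> jk [[y' [a [-> -> xy xa w]]]|h|h]; [|exact: Or32|exact: Or33].
by apply: Or31; exists y', a; split=> //; exact: bwalk_mono w.
Qed.

(** A step inside a star keeps the germ. A step of the base graph lengthens the walk off [x] by one.
    The remaining cases are entering and leaving the star of some [c], and they depend on whether
    its hull contains [x]. *)
Lemma near_step j y p p' : near j y p -> star_rel p p' -> p <> vX x -> p' <> vX x ->
  exists2 y1, bwalk (germ_rel (j + L)) 2 y y1 & near (j + L.+1) y1 p'.
Proof.
move=> yp pp' px p'x.
have stay : near (j + L.+1) y p' ->
    exists2 y1, bwalk (germ_rel (j + L)) 2 y y1 & near (j + L.+1) y1 p'.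
  by exists y => //; exact: bwalk0.
have same_star c : star p = Some c -> star p' = Some c -> near (j + L.+1) y p'.
  move=> pc p'c; apply: near_mono (leq_addr _ _) _.
  case: yp => [[y' [a [_ pE _ _]]]|[c' [h [y' [pc' nc hh -> xyw]]]]|[c' [pc' hx ->]]].
  - by rewrite pE in pc.
  - by move: pc'; rewrite pc => -[E]; subst c'; apply: Or32; exists c, h, y'.
  - by move: pc'; rewrite pc => -[E]; subst c'; apply: Or33; exists c.
case: pp' => [[a [b [pE p'E ab]]]|[c [s [i [hs iL pE p'E]]]]|[c [s [i [hs iL p'E pE]]]]].
- apply: stay; subst; case: yp => [[y' [a' [-> [<-] xy w]]]|[c' [h [y' []]]]|[c' []]] //.
  apply: Or31; exists y', b; split=> //.
  apply: (@bwalk_mono _ _ j.+1); first by rewrite addnS ltnS leq_addr.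
  apply: bwalk_snoc w _; split=> //; first by move=> E; apply: px; rewrite E.
  by move=> E; apply: p'x; rewrite E.
- case: (posnP i) => [i0|i0]; last first.
    by apply: stay; apply: (same_star c); rewrite ?pE ?p'E star_lp.
  subst i; rewrite lp0 in pE; subst p p'.
  have sx : s <> x by move=> E; apply: px; rewrite E.
  case: yp => [[y' [a' [yE [aE] xy w]]]|[c' [h [y' []]]]|[c' []]] //; subst a' y.
  have [hx|hx] := pselect (hull c x); last first.
    apply: stay; apply: Or32; exists c, s, y'; split=> //; first exact: star_lp.
    by split=> //; apply: bwalk_mono w; exact: leq_addr.
  (* Two moves: through [s] to an edge [y1] at [x] within the hull, then to the spoke from [x] to
     [c]. *)
  have [y1 [hy1 xy1 w1]] := hull_exit hx hs sx.
  exists (lp c x 1); last by apply: Or33; exists c; split=> //; exact: star_lp.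
  apply: (@bwalkS _ _ _ _ (vX y1)); last apply: bwalk1.
    by apply: Or31; exists y', y1; split=> //; exact: bwalk_cat w w1.
  by apply: Or33; exists c, y1.
- case: (posnP i) => [i0|i0]; last first.
    by apply: stay; apply: (same_star c); rewrite ?pE ?p'E star_lp.
  subst i; rewrite lp0 in p'E; subst p p'.
  have sx : s <> x by move=> E; apply: p'x; rewrite E.
  case: yp => [[y' [a' [yE pE xy w]]]|[c' [h [y' [cE nhx hh yE [xy w]]]]]|[c' [cE hx yE]]].
  + by have [] := lp_vX pE.
  + move: cE; rewrite star_lp // => -[cE]; subst c' y.
    (* The hull avoids [x], so it connects the point [h] to the exit [s] by at most [L] steps off
       [x]. *)
    apply: stay; apply: Or31; exists y', s; split=> //.
    apply: (@bwalk_mono _ _ (j + L)); first by rewrite leq_add2l.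
    apply: bwalk_cat w _; apply: bwalk_sub (hull_conn hh hs) => a b [ab ha hb].
    by split=> // E; subst.
  + move: cE; rewrite star_lp // => -[cE]; subst c' y.
    have [y1 [hy1 xy1 w1]] := hull_exit hx hs sx.
    exists (vX y1).
      by apply: (@bwalk_mono _ _ 1) => //; apply: bwalk1; apply: Or32; exists c, y1.
    apply: Or31; exists y1, s; split=> //.
    apply: (@bwalk_mono _ _ L); first by rewrite addnS ltnW // ltnS leq_addl.
    exact: bwalk_sym (off_sym rC) w1.
Qed.

Lemma near_walk n j y p z : near j y p -> bwalk (off (vX x) star_rel) n p z ->
  exists2 y1, bwalk (germ_rel (j + n * L.+1)) (n * 2) y y1 & near (j + n * L.+1) y1 z.
Proof.
move=> yp w; elim: w j y yp => {n p z} [n p|n p q z [pq px qx] _ IH] j y yp.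
  by exists y; [exact: bwalk0|apply: near_mono yp; exact: leq_addr].
have [y1 w1 y1q] := near_step yp pq px qx.
have [y2 w2 y2z] := IH _ _ y1q.
have E : (j + L.+1 + n * L.+1 = j + n.+1 * L.+1)%N by rewrite mulSn addnA.
rewrite E in w2 y2z; exists y2 => //; rewrite [(n.+1 * 2)%N]mulSn.
apply: bwalk_cat w2; apply: bwalk_sub w1 => a b; apply: germ_rel_mono.
by rewrite leq_add2l mulSn; apply: leq_trans (leq_addr _ _); exact: leqnSn.
Qed.

(** An edge at [x] makes bounded angles with finitely many edges by [angfine] and lies in finitely
    many hulls by [hull_edge]; a spoke is related only to edges with end in one finite hull. *)
Lemma germ_rel_finite m y : angfine r -> finite_set [set z | germ_rel m y z].
Proof.
move=> fin; case: (pselect (exists y', y = vX y')) => [[y' yE]|ny].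
  have [xy|nxy] := pselect (r x y'); last first.
    apply: sub_finite_set (@finite_set0 star_graph).
    move=> z [[y1 [z' [yE' _ ry1 _ _]]]|[c [y1 [yE' _ _ _ _]]]|[c [y1 [_ yE' _ _ ry1]]]].
    - by move: yE'; rewrite yE => -[E]; subst.
    - by have [] := lp_vX (esym (etrans (esym yE) yE')).
    - by move: yE'; rewrite yE => -[E]; subst.
  apply: (@sub_finite_set _ _
    ((vX @` [set z | r x z /\ bwalk (off x r) m y' z]) `|`
     ((fun c => lp c x 1) @` [set c | hull c x /\ hull c y']))).
    move=> z [[y1 [z' [yE' -> ry1 rz w]]]|[c [y1 [yE' _ _ _ _]]]|[c [y1 [-> yE' hx hy ry1]]]].
    - by move: yE'; rewrite yE => -[E]; subst; left; exists z'.
    - by have [] := lp_vX (esym (etrans (esym yE) yE')).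
    - by move: yE'; rewrite yE => -[E]; subst; right; exists c.
  by rewrite finite_setU; split; apply: finite_image; [exact: fin|exact: hull_edge].
case E : (star y) => [c|]; last first.
  apply: sub_finite_set (@finite_set0 star_graph).
  move=> z [[y1 [z' [yE _ _ _ _]]]|[c [y1 [yE _ _ _ _]]]|[c [y1 [_ yE _ _ _]]]].
  - by apply: ny; exists y1.
  - by move: E; rewrite yE star_lp.
  - by apply: ny; exists y1.
apply: sub_finite_set (finite_image vX (hull_finite c)).
move=> z [[y1 [z' [yE _ _ _ _]]]|[c' [y1 [yE -> _ hy _]]]|[c' [y1 [_ yE _ _ _]]]].
- by case: ny; exists y1.
- by move: E; rewrite yE star_lp // => -[<-]; exists y1.
- by case: ny; exists y1.
Qed.

End AngleAtX.

(** A point off the base graph has all its neighbours in one finite star. At a point of the base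
    graph, the germ is tracked along the walk. *)
Lemma star_angfine : angfine r -> angfine star_rel.
Proof.
move=> fin p y n py; case: (star_graphP p) => [[x pE]|[c [s [i [hs /andP[i0 iL] pE]]]]]; last first.
  apply: (@sub_finite_set _ _ ((fun q => lp c q.1 q.2) @` (hull c `*` `I_L.+1))).
    move=> z [pz _]; rewrite pE in pz.
    by have [t [j [ht jL ->]]] := star_rel_lp hs i0 pz; exists (t, j).
  by apply: finite_image; apply: finite_setX; [exact: hull_finite|exact: finite_II].
subst p.
have yy : near x 0 y y.
  case: (star_relX py) => [[y' xy ->]|[c hx ->]].
    by apply: Or31; exists y', y'; split=> //; exact: bwalk0.
  by apply: Or33; exists c; split=> //; exact: star_lp.
(* Each step of the walk costs at most two moves; one further move may lead from the germ near [z]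
   to [z] itself. *)
apply: sub_finite_set (bwalk_finite (n * 2).+1 y
  (fun y => @germ_rel_finite x (0 + n * L.+1) y fin)).
move=> z [xz w] /=; have [y1 w1 y1z] := near_walk yy w.
case: (star_relX xz) => [[z' rz zE]|[c hx zE]]; subst z.
  case: y1z => [[y' [a [y1E [aE] ry w']]]|[c' [h [y' []]]]|[c' []]] //; subst a.
  by apply: bwalk_snoc w1 _; apply: Or31; exists y', z'.
case: y1z => [[y' [a [_ pE _ _]]]|[c' [h [y' [cE nhx _ _ _]]]]|[c' [cE _ yE]]].
- by have [] := lp_vX pE.
- by move: cE; rewrite star_lp // => -[cE]; subst.
- move: cE; rewrite star_lp // => -[cE]; subst.
  by apply: bwalk_mono w1.
Qed.

End Stars.

Local Open Scope group_scope.

(** * Topological groups acting on fine graphs *)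

Lemma compact_bigcup (S : topologicalType) (I : choiceType) (F : set I)
    (A : I -> set S) :
  finite_set F -> (forall i, F i -> compact (A i)) ->
  compact (\bigcup_(i in F) A i).
Proof.
move=> /finite_seqP[s ->] cA; rewrite bigcup_seq big_seq_cond.
by apply: bigsetU_compact => i; rewrite andbT => /cA.
Qed.

Section TopologicalGroups.
Variable G : topologicalGroupType.
Implicit Types (g h : G) (A K U : set G).

(** The two-sided form covers cosets, with [h = 1], and conjugates, with [h = g^-1]. *)
Lemma translate_continuous g h : continuous (fun x : G => g * x * h).
Proof.
have mul_cvg (a b : G -> G) (x : G) : a y @[y --> x] --> a x ->
    b y @[y --> x] --> b x -> a y * b y @[y --> x] --> a x * b x.
  move=> ax bx; apply: (@continuous2_cvg _ G G G _ _ _ _ (fun u v : G => u * v)) => //.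
  exact: (@mulg_continuous G (a x, b x)).
move=> x; apply: (mul_cvg (fun y => g * y) (fun=> h)); last exact: cvg_cst.
by apply: (mul_cvg (fun=> g) id); [exact: cvg_cst|exact: cvg_id].
Qed.

Lemma compact_translate g h A : compact A -> compact [set g * x * h | x in A].
Proof.
by apply: continuous_compact; apply: continuous_subspaceT; exact: translate_continuous.
Qed.

Lemma open_translate g h U : open U -> open [set g * x * h | x in U].
Proof.
move=> oU; have -> : [set g * x * h | x in U] = (fun x => g^-1 * x * h^-1) @^-1` U.
  apply/seteqP; split => [_ [x Ux <-]|x /= Ux].
    by rewrite /= -!mulgA mulgV mulg1 mulKg.
  by exists (g^-1 * x * h^-1) => //; rewrite !mulgA mulgV mul1g mulgVK.
by apply: open_comp => // x _; exact: translate_continuous.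
Qed.

Lemma open_subgroup_closed K : is_subgroup K -> open K -> closed K.
Proof.
move=> sK oK; rewrite -[K]setCK; apply: open_closedC; rewrite openE => x /= nKx.
have [K1 KM KV] := sK.
rewrite /interior; apply: filterS (_ : nbhs x [set x * y * 1 | y in K]).
  move=> _ [y Ky <-]; rewrite mulg1 => Kxy; apply: nKx.
  by rewrite -(mulgK y x); apply: KM => //; exact: KV.
apply: open_nbhs_nbhs; split; first exact: open_translate.
by exists 1; rewrite // !mulg1.
Qed.

(** If the image were infinite, the sets containing [A] up to finitely many fibres of [f] would form
    a proper filter. At a cluster point [a] this is contradicted by the open coset of [a], on which
    [f] is constant. *)
Lemma compact_finite_image (Y : Type) (f : G -> Y) K A :
  is_subgroup K -> open K -> (forall g k, K k -> f (g * k) = f g) ->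
  compact A -> finite_set (f @` A).
Proof.
move=> [K1 _ _] oK fK cA; apply: contrapT => inf.
pose F : set_system G :=
  [set U | exists2 S, finite_set S & A `\` (f @^-1` S) `<=` U].
have FF : ProperFilter F.
  apply: Build_ProperFilter_ex.
    move=> U [S fS AU]; apply: contrapT => nU; apply: inf.
    apply: sub_finite_set fS => _ [x Ax <-]; apply: contrapT => nSx.
    by apply: nU; exists x; apply: AU.
  split.
  - by exists set0 => //; exact: finite_set0.
  - move=> U V [S fS AU] [S' fS' AV]; exists (S `|` S').
      by rewrite finite_setU.
    by move=> x [Ax nS]; split; [apply: AU|apply: AV]; split=> // Sx; apply: nS;
       [left|right].
  - by move=> U V UV [S fS AU]; exists S => //; exact: subset_trans UV.
have [|a [Aa clua]] := cA F FF.
  by exists set0; [exact: finite_set0|move=> x []].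
have Fa : F (A `\` (f @^-1` [set f a])).
  by exists [set f a]; first exact: finite_set1.
have [|x [[Ax nfx] [k Kk kE]]] := clua _ [set a * k * 1 | k in K] Fa.
  apply: open_nbhs_nbhs; split; first exact: open_translate.
  by exists 1; rewrite // !mulg1.
by apply: nfx; rewrite /= -kE mulg1 fK.
Qed.

End TopologicalGroups.

(** * Actions with open stabilizers *)

Section Actions.
Variables (G : topologicalGroupType) (X : choiceType) (act : G -> X -> X).
Hypotheses (act1 : forall x, act 1 x = x)
  (actM : forall g h x, act (g * h) x = act g (act h x)).

Local Notation stab := (vertex_stab act).

Lemma actK g x : act g^-1 (act g x) = x.
Proof. by rewrite -actM mulVg act1. Qed.

Lemma act_inj g : injective (act g).
Proof. by move=> x y /(congr1 (act g^-1)); rewrite !actK. Qed.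

Lemma stab_subgroup x : is_subgroup (stab x).
Proof.
split; first exact: act1.
- by move=> g h /= gx hx; rewrite /vertex_stab /= actM hx gx.
- by move=> g /= gx; rewrite /vertex_stab /= -{1}gx actK.
Qed.

Lemma stab_act g x : stab (act g x) = conj_set g (stab x).
Proof.
apply/seteqP; split => [h /= hx|_ [h /= hx <-]]; last first.
  by rewrite /vertex_stab /= !actM actK hx.
exists (g^-1 * h * g); last by rewrite !mulgA mulgV mul1g mulgK.
by rewrite /vertex_stab /= !actM hx actK.
Qed.

Lemma orbit_finite K y : open (stab y) -> compact K ->
  finite_set [set act k y | k in K].
Proof.
move=> oy; apply: compact_finite_image (stab_subgroup y) oy _ => g k ky.
by rewrite actM ky.
Qed.

Lemma stab_closed x : open (stab x) -> closed (stab x).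
Proof. by apply: open_subgroup_closed; exact: stab_subgroup. Qed.

(** A transporter is empty or a left translate of the pair stabilizer. *)
Lemma transporter_compact x y z t : compact (stab x `&` stab y) ->
  compact [set g | act g x = z /\ act g y = t].
Proof.
move=> cxy; set A := [set g | _].
have [->|/set0P[g0 [g0x g0y]]] := eqVneq A set0; first exact: compact0.
suff -> : A = [set g0 * g * 1 | g in stab x `&` stab y] by exact: compact_translate.
apply/seteqP; split => [g [gx gy]|_ [g [gx gy] <-]].
  exists (g0^-1 * g); last by rewrite mulg1 mulVKg.
  by split; rewrite /vertex_stab /= actM ?gx ?gy -?g0x -?g0y actK.
by rewrite mulg1; split; rewrite actM ?gx ?gy.
Qed.

Lemma compact_edge_stab x y : compact (stab x `&` stab y) ->
  compact (edge_stab act x y).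
Proof.
move=> cxy; rewrite (_ : edge_stab act x y =
  [set g | act g x = x /\ act g y = y] `|` [set g | act g x = y /\ act g y = x]) //.
by apply: compactU; exact: transporter_compact.
Qed.

Lemma compact_pair_stab x y : open (stab x) -> open (stab y) ->
  compact (edge_stab act x y) -> compact (stab x `&` stab y).
Proof.
move=> ox oy ce; apply: subclosed_compact ce _; last by move=> g []; left.
by apply: closedI; exact: stab_closed.
Qed.

Variable adj : rel X.
Hypothesis act_adj : forall g x y, adj (act g x) (act g y) = adj x y.

Lemma act_path g x p : path adj (act g x) (map (act g) p) = path adj x p.
Proof. by elim: p x => //= y p IH x; rewrite act_adj IH. Qed.

(* A group fixing [x] and [y] permutes the finitely many embedded paths of a
   given length from [x] to [y]. *)
Lemma fine_pair_stab_compact x y :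
  fine adj -> graph_connected adj -> (forall z, open (stab z)) ->
  (forall z t, adj z t -> compact (stab z `&` stab t)) ->
  x <> y -> compact (stab x `&` stab y).
Proof.
move=> fin [_ conn] ost cst xy.
have [p [xp lp]] := conn x y.
case/shortenP: xp lp => p' xp up _ lp {p}.
case: p' xp up lp => [|z p] xp up lp //; case/andP: (xp) => xz _.
set P := [set q | [/\ edge_path adj x y q, uniq (x :: q) & size q = (size p).+1]].
have fP : finite_set P by exact: fin.
(* The group elements are sorted by the image [t] of the vertex [z] following [x] on the path; each
   class lies in a transporter of the edge from [x] to [z]. *)
apply: (@subclosed_compact _ _
  (\bigcup_(t in head x @` P) [set g | act g x = x /\ act g z = t])).
- by apply: closedI; exact: stab_closed.
- apply: compact_bigcup; first exact: finite_image.
  by move=> t _; apply: transporter_compact; exact: cst.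
move=> g [gx gy]; exists (act g z) => //; exists (map (act g) (z :: p)) => //.
split; last by rewrite size_map.
  split; first by rewrite -{1}gx act_path.
  by rewrite -[X in last X]gx last_map lp.
by rewrite -{1}gx -map_cons map_inj_uniq //; exact: act_inj.
Qed.

End Actions.

(** Fineness yields the orbit condition: a subgroup that is the stabilizer of two distinct vertices
    is compact. *)
Lemma cayley_abels_fine (G : topologicalGroupType) (X : choiceType)
    (adj : rel X) (act : G -> X -> X) (HH : set (set G)) :
  simplicial adj -> graph_connected adj -> acts_on_graph adj act ->
  cocompact_action adj act -> (forall x, open (vertex_stab act x)) ->
  (forall x y, adj x y -> compact (vertex_stab act x `&` vertex_stab act y)) ->
  (forall x, compact (vertex_stab act x) \/
    exists2 H, HH H & conjugate H (vertex_stab act x)) ->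
  (forall H, HH H -> exists x, vertex_stab act x = H) ->
  fine adj -> cayley_abels adj act HH.
Proof.
move=> sim con [a1 aM aa] coc ost cst ver par fin; split=> //.
- by split=> // x y _; exact: openI.
- by move=> x y /cst; exact: compact_edge_stab.
- move=> H x y _ ncH xH yH; have [->|/eqP xy] := eqVneq x y.
    by exists 1; rewrite a1.
  case: ncH; rewrite -(setIid H) -{1}xH -yH.
  exact: fine_pair_stab_compact.
Qed.

(** * Adding a vertex fixed by a compact open subgroup *)

Lemma finite_uniform (T : eqType) (A : set T) (Q : T -> nat -> Prop) :
  finite_set A -> (forall a m n, (m <= n)%N -> Q a m -> Q a n) ->
  (forall a, A a -> exists n, Q a n) -> exists n, forall a, A a -> Q a n.
Proof.
move=> /finite_seqP[s ->] mono; elim: s => [|x s IH] ex; first by exists 0.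
have [|n nP] := IH; first by move=> a /= as_; apply: ex; rewrite /= inE as_ orbT.
have [|m mP] := ex x; first by rewrite /= inE eqxx.
exists (n + m)%N => a /=; rewrite inE => /orP[/eqP->|as_].
  by apply: mono mP; exact: leq_addl.
by apply: mono (nP _ as_); exact: leq_addr.
Qed.

Lemma open_supgroup (G : topologicalGroupType) (U V : set G) :
  is_subgroup U -> open V -> V 1 -> V `<=` U -> open U.
Proof.
move=> [U1 UM UV] oV V1 VU; rewrite openE => x Ux; rewrite /interior.
apply: filterS (_ : nbhs x [set x * y * 1 | y in V]).
  by move=> _ [y Vy <-]; rewrite mulg1; apply: UM => //; exact: VU.
apply: open_nbhs_nbhs; split; first exact: open_translate.
by exists 1; rewrite // !mulg1.
Qed.

(** * Left cosets as a set with an action *)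

Section Cosets.
Variables (G : topologicalGroupType) (K : set G).
Hypothesis sK : is_subgroup K.

Definition is_coset (c : set G) : Prop := exists g, c = [set g * k | k in K].

Definition coset_space : choiceType := {c : set G | `[< is_coset c >]}.

Lemma is_coset_gen g : `[< is_coset [set g * k | k in K] >].
Proof. by apply/asboolP; exists g. Qed.

Definition coset (g : G) : coset_space :=
  exist (fun c : set G => `[< is_coset c >]) _ (is_coset_gen g).

Lemma coset_eq g h : coset g = coset h <-> K (g^-1 * h).
Proof.
have [K1 KM KV] := sK.
split=> [/(congr1 val) /= E|Kgh].
  have : [set h * k | k in K] h by exists 1; rewrite ?mulg1.
  by rewrite -E => -[k Kk <-]; rewrite mulKg.
apply: val_inj => /=; apply/seteqP; split => _ [k Kk <-].
  exists ((g^-1 * h)^-1 * k); first by apply: KM => //; exact: KV.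
  by rewrite invgM invgK -!mulgA mulVKg.
exists (g^-1 * h * k); first exact: KM.
by rewrite !mulgA mulgV mul1g.
Qed.

Lemma coset_surj c : exists g, c = coset g.
Proof. by case: c => c /[dup] /asboolP[g cE] h; exists g; apply: val_inj. Qed.

Definition coset_rep (c : coset_space) : G := sval (cid (coset_surj c)).

Lemma coset_repK c : coset (coset_rep c) = c.
Proof. by rewrite /coset_rep; case: cid. Qed.

Definition coset_act (g : G) (c : coset_space) := coset (g * coset_rep c).

Lemma coset_actE g h : coset_act g (coset h) = coset (g * h).
Proof.
apply/coset_eq; rewrite invgM -mulgA (mulKg g).
by apply/coset_eq; rewrite coset_repK.
Qed.

Lemma coset_act1 c : coset_act 1 c = c.
Proof. by rewrite /coset_act mul1g coset_repK. Qed.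

Lemma coset_actM g h c : coset_act (g * h) c = coset_act g (coset_act h c).
Proof. by rewrite -(coset_repK c) !coset_actE mulgA. Qed.

Lemma coset_stab1 : vertex_stab coset_act (coset 1) = K.
Proof.
have [K1 KM KV] := sK.
apply/seteqP; split => g; rewrite /vertex_stab /= coset_actE mulg1.
  by move=> /coset_eq; rewrite mulg1 => /KV; rewrite invgK.
by move=> Kg; apply/coset_eq; rewrite mulg1; exact: KV.
Qed.

Lemma coset_stab c : exists g, vertex_stab coset_act c = conj_set g K.
Proof.
have [g ->] := coset_surj c; exists g.
by rewrite -coset_stab1 -(stab_act coset_act1 coset_actM) coset_actE mulg1.
Qed.

End Cosets.

(** * Finite connected subgraphs invariant under a compact subgroup *)

Section Hull.
Variables (G : topologicalGroupType) (X : choiceType) (adj : rel X).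
Variables (act : G -> X -> X) (K : set G).
Hypotheses (action : acts_on_graph adj act) (aC : symmetric adj).
Hypotheses (conn : graph_connected adj).
Hypotheses (open_stab : forall x, open (vertex_stab act x)).
Hypotheses (sK : is_subgroup K) (cK : compact K).

Lemma path_inside (H : set X) x p y :
  path adj x p -> (forall z, z \in x :: p -> H z) -> y \in x :: p ->
  exists n, bwalk (inside H (edgeP adj)) n x y.
Proof.
elim: p x => [|z p IH] x /=.
  by move=> _ _; rewrite inE => /eqP->; exists 0; exact: bwalk0.
case/andP=> xz zp Hp; rewrite inE => /orP[/eqP->|yp].
  by exists 0; exact: bwalk0.
have [|n w] := IH z zp _ yp; first by move=> t tp; apply: Hp; rewrite inE tp orbT.
exists n.+1; apply: bwalkS w; split=> //; apply: Hp; rewrite inE ?eqxx //.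
by rewrite mem_head orbT.
Qed.

(** The orbit of [x0] under [K] is finite. [P] collects paths from [x0] to all its points, and [H]
    consists of the [K]-translates of [P]. A translated point [act k y] is joined to [act k x0] by a
    translated path, and [act k x0] to [x0] within [P]. *)
Lemma invariant_hull : exists (H : set X) (L : nat),
  [/\ finite_set H, H !=set0, forall k h, K k -> H h -> H (act k h), (0 < L)%N &
    forall s t, H s -> H t -> bwalk (inside H (edgeP adj)) L s t].
Proof.
have [a1 aM aa] := action; have [K1 KM KV] := sK.
have [[x0] cn] := conn.
have [q qP] := choice (cn x0).
pose S := [set act k x0 | k in K].
have fS : finite_set S by exact: (orbit_finite a1 aM).
pose P := \bigcup_(s in S) [set` x0 :: q s].
have fP : finite_set P by apply: bigcup_finite => // s _; exact: finite_seq.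
pose H := \bigcup_(y in P) [set act k y | k in K].
have fH : finite_set H.
  by apply: bigcup_finite => // y _; exact: (orbit_finite a1 aM).
have PH : P `<=` H by move=> y Py; exists y => //; exists 1.
have KH k h : K k -> H h -> H (act k h).
  move=> Kk [y Py [k' Kk' <-]]; exists y => //; exists (k * k'); first exact: KM.
  by rewrite aM.
have Sx0 : S x0 by exists 1.
have P0 : P x0 by exists x0; rewrite //= mem_head.
have EC : sym (inside H (edgeP adj)).
  by apply: inside_sym => x y; rewrite /edgeP aC.
have fromx0 y : P y -> exists n, bwalk (inside H (edgeP adj)) n x0 y.
  move=> [s Ss ys]; have [xq lq] := qP s; apply: path_inside xq _ ys => z zq.
  by apply: PH; exists s.
have toH h : H h -> exists n, bwalk (inside H (edgeP adj)) n x0 h.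
  move=> [y Py [k Kk <-]]; have [n w] := fromx0 y Py.
  have [|m w'] := fromx0 (act k x0).
    exists (act k x0); first by exists k.
    by have [_ lq] := qP (act k x0); have := mem_last x0 (q (act k x0)); rewrite lq.
  exists (m + n)%N; apply: bwalk_cat w' _.
  apply: bwalk_map w => a b [ab Ha Hb]; right; split; last 2 first.
  - exact: KH.
  - exact: KH.
  - by rewrite /edgeP aa.
have [L LP] := finite_uniform fH (fun a m n mn => bwalk_mono mn) toH.
(* Two points are joined through [x0]; the successor makes the length positive. *)
exists H, (L + L).+1; split=> //; first by exists x0; exact: PH.
move=> s t Hs Ht; apply: (@bwalk_mono _ _ (L + L)) => //.
by apply: bwalk_cat (bwalk_sym EC (LP s Hs)) (LP t Ht).
Qed.

End Hull.

Record relhyp_graph (G : topologicalGroupType) (HH : set (set G)) := RelHypGraph {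
  rg_vert : choiceType;
  rg_adj : rel rg_vert;
  rg_act : G -> rg_vert -> rg_vert;
  rg_ca : cayley_abels rg_adj rg_act HH;
  rg_fine : fine rg_adj;
  rg_hyp : gromov_hyperbolic rg_adj }.

(** * The action on the graph with a star for each coset of a compact open subgroup *)

Section AddFixedVertex.
Variables (G : topologicalGroupType) (HH : set (set G)) (D : relhyp_graph HH).
Variable K : set G.
Hypotheses (sK : is_subgroup K) (oK : open K) (cK : compact K).

Local Notation X := (rg_vert D).
Local Notation adj := (@rg_adj _ _ D).
Local Notation act := (@rg_act _ _ D).

Variables (H : set X) (L : nat).
Hypotheses (H_finite : finite_set H) (H_neq0 : H !=set0).
Hypothesis KH : forall k h, K k -> H h -> H (act k h).
Hypothesis L_gt0 : (0 < L)%N.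
Hypothesis H_conn : forall s t, H s -> H t -> bwalk (inside H (edgeP adj)) L s t.

Local Notation C := (coset_space K).
Local Notation actC := (@coset_act G K).

Let a1 : forall x, act 1 x = x.
Proof. by have [] := ca_action (rg_ca D). Qed.
Let aM : forall g h x, act (g * h) x = act g (act h x).
Proof. by have [] := ca_action (rg_ca D). Qed.
Let aa : forall g x y, adj (act g x) (act g y) = adj x y.
Proof. by have [] := ca_action (rg_ca D). Qed.
Let aC : symmetric adj. Proof. by have [] := ca_simplicial (rg_ca D). Qed.
Let aI : irreflexive adj. Proof. by have [] := ca_simplicial (rg_ca D). Qed.
Let ost x : open (vertex_stab act x).
Proof. by have [+ _] := ca_discrete (rg_ca D); apply. Qed.
Let c1 := @coset_act1 G K.
Let cM := coset_actM sK.

Let pair_compact x y : adj x y -> compact (vertex_stab act x `&` vertex_stab act y).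
Proof. by move=> /(ca_edges (rg_ca D)); exact: compact_pair_stab. Qed.

Definition coset_hull (c : C) : set X := [set act (coset_rep c) h | h in H].

(** Two representatives differ by an element of [K], which preserves [H]. *)
Lemma coset_hullE g : coset_hull (coset K g) = [set act g h | h in H].
Proof.
have : K ((coset_rep (coset K g))^-1 * g).
  by apply/(coset_eq sK); rewrite coset_repK.
set r := coset_rep _ => Krg.
have [_ _ KV] := sK.
apply/seteqP; rewrite /coset_hull -/r; split => _ [h Hh <-].
  exists (act (g^-1 * r) h).
    by apply: KH => //; have := KV _ Krg; rewrite invgM invgK.
  by rewrite -aM mulVKg.
exists (act (r^-1 * g) h); first exact: KH.
by rewrite -aM mulVKg.
Qed.

Lemma coset_hull_act g c s : coset_hull c s -> coset_hull (actC g c) (act g s).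
Proof.
have [h ->] := coset_surj c; rewrite (coset_actE sK) !coset_hullE => -[x Hx <-].
by exists x; rewrite // aM.
Qed.

Let hull_neq0 c : coset_hull c !=set0.
Proof. by have [x Hx] := H_neq0; exists (act (coset_rep c) x), x. Qed.

Let hull_finite c : finite_set (coset_hull c).
Proof. exact: finite_image. Qed.

Let hull_conn c s t : coset_hull c s -> coset_hull c t ->
  bwalk (inside (coset_hull c) (edgeP adj)) L s t.
Proof.
move=> [a Ha <-] [b Hb <-]; apply: bwalk_map (H_conn Ha Hb) => x y [xy Hx Hy].
right; split; last 2 first.
- by exists x.
- by exists y.
- by rewrite /edgeP aa.
Qed.

(** For each of the finitely many pairs in [H], the elements that carry it to [x] and [y] form a
    compact set, which meets finitely many cosets of the open subgroup [K]. *)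
Let hull_edge x y : edgeP adj x y ->
  finite_set [set c | coset_hull c x /\ coset_hull c y].
Proof.
move=> xy; apply: (@sub_finite_set _ _ (\bigcup_(h in H) \bigcup_(h' in H)
  (@coset G K @` [set g | act g h = x /\ act g h' = y]))).
  move=> c [[h Hh hx] [h' Hh' hy]]; exists h => //; exists h' => //.
  by exists (coset_rep c) => //; exact: coset_repK.
apply: bigcup_finite => // h Hh; apply: bigcup_finite => // h' Hh'.
have [hh'|nhh'] := boolP (adj h h').
  apply: compact_finite_image sK oK _ _.
    move=> g k Kk; apply/(coset_eq sK); rewrite invgM -mulgA mulVg mulg1.
    by have [_ _ KV] := sK; exact: KV.
  by apply: transporter_compact => //; exact: pair_compact.
apply: sub_finite_set (@finite_set0 C) => c [g [gx gy] _].
by case/negP: nhh'; rewrite -(aa g) gx gy.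
Qed.

Local Notation V := (star_graph coset_hull L).
Local Notation lpK := (@lp X C coset_hull L).
Local Notation E := (@star_rel X C (edgeP adj) coset_hull L).

(** On a leg the action goes through [lp], which tests membership in the hull itself, so that no
    proof is transported; by [coset_hull_act] the test succeeds. *)
Definition star_act (g : G) (p : V) : V :=
  match p with
  | inl (inl x) => vX _ _ (act g x)
  | inl (inr c) => ctr _ _ (actC g c)
  | inr q => lpK (actC g (val q).1.1) (act g (val q).1.2) (val q).2
  end.

Lemma star_act_lp g c s i : coset_hull c s -> (i <= L)%N ->
  star_act g (lpK c s i) = lpK (actC g c) (act g s) i.
Proof.
move=> hs; case: (posnP i) => [->|i0]; first by rewrite !lp0.
rewrite leq_eqVlt => /orP[/eqP->|iL]; first by rewrite !lpL.
have h : `[< coset_hull c s >] && (0 < i < L) by rewrite i0 iL !andbT; apply/asboolP.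
by rewrite (lp_leg h).
Qed.

Let EC : sym (edgeP adj). Proof. by move=> x y; rewrite /edgeP aC. Qed.

Let starP := star_graphP L_gt0 hull_neq0.

Lemma star_act1 p : star_act 1 p = p.
Proof.
case: (starP p) => [[x ->]|[c [s [i [hs /andP[_ iL] ->]]]]]; first by rewrite /= a1.
by rewrite star_act_lp // c1 a1.
Qed.

Lemma star_actM g h p : star_act (g * h) p = star_act g (star_act h p).
Proof.
case: (starP p) => [[x ->]|[c [s [i [hs /andP[_ iL] ->]]]]]; first by rewrite /= aM.
rewrite !star_act_lp //; last exact: coset_hull_act.
by rewrite cM aM.
Qed.

Lemma star_act_rel g p q : E p q -> E (star_act g p) (star_act g q).
Proof.
have spoke_act u v : spoke u v -> @spoke X C coset_hull L (star_act g u) (star_act g v).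
  move=> [c [s [i [hs iL -> ->]]]]; exists (actC g c), (act g s), i; split=> //.
  - exact: coset_hull_act.
  - by rewrite star_act_lp // ltnW.
  - by rewrite star_act_lp.
case=> [[x [y [-> -> xy]]]|/spoke_act|/spoke_act]; [|exact: Or32|exact: Or33].
by apply: Or31; exists (act g x), (act g y); rewrite /edgeP aa.
Qed.

Definition star_adj : rel V := fun p q => `[< E p q >].

Lemma star_adjE : edgeP star_adj = E.
Proof.
by apply/funext => p; apply/funext => q; apply/propext; split => /asboolP.
Qed.

Lemma star_simplicial : simplicial star_adj.
Proof.
split=> [p q|p].
  by apply/asboolP/asboolP; exact: star_rel_sym.
apply/asboolP => -[[x [y [-> [<-]]]]|[c [s [i [hs iL -> pE]]]]|[c [s [i [hs iL -> pE]]]]].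
- by rewrite /edgeP aI.
- have := congr1 (@level _ _ _ _) pE; rewrite !level_lp //; last exact: ltnW.
  by move/eqP; rewrite ltn_eqF.
- have := congr1 (@level _ _ _ _) pE; rewrite !level_lp //; last exact: ltnW.
  by move/eqP; rewrite ltn_eqF.
Qed.

Lemma star_fine : fine star_adj.
Proof.
apply: angfine_fine; first exact: star_simplicial.
rewrite star_adjE; apply: star_angfine => //.
by apply: fine_angfine; [exact: ca_simplicial (rg_ca D)|exact: rg_fine].
Qed.

Let cn : forall x y, exists n, bwalk (edgeP adj) n x y.
Proof. by have /graph_connectedP[] := ca_connected (rg_ca D). Qed.

Lemma star_connected : graph_connected star_adj.
Proof.
apply/graph_connectedP; split.
  have [[x] _] := ca_connected (rg_ca D); exact: (inhabits (vX _ _ x)).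
by rewrite star_adjE => p q; exact: star_conn.
Qed.

Lemma star_hyperbolic : gromov_hyperbolic star_adj.
Proof.
apply/hyperbolic_fourpt; rewrite graph_distE star_adjE.
have /hyperbolic_fourpt[N] := rg_hyp D; rewrite graph_distE => four.
by apply: star_fourpt four.
Qed.

Lemma star_acts : acts_on_graph star_adj star_act.
Proof.
split; [exact: star_act1|exact: star_actM|move=> g p q].
apply/asboolP/asboolP; last exact: star_act_rel.
move=> /(star_act_rel g^-1); rewrite -!star_actM mulVg !star_act1; exact.
Qed.

Lemma star_stab_vX x : vertex_stab star_act (vX _ _ x) = vertex_stab act x.
Proof. by apply/seteqP; split => g; rewrite /vertex_stab /=; [case|move=> ->]. Qed.

Let stabC_open c : open (vertex_stab actC c).
Proof. by have [g ->] := coset_stab sK c; exact: open_translate. Qed.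

Let stabC_compact c : compact (vertex_stab actC c).
Proof. by have [g ->] := coset_stab sK c; exact: compact_translate. Qed.

Lemma star_stab_open p : open (vertex_stab star_act p).
Proof.
case: (starP p) => [[x ->]|[c [s [i [hs /andP[_ iL] ->]]]]].
  by rewrite star_stab_vX.
apply: (@open_supgroup _ _ (vertex_stab actC c `&` vertex_stab act s)).
- exact: stab_subgroup star_act1 star_actM _.
- exact: openI.
- by split; [exact: c1|exact: a1].
- by move=> g [gc gs]; rewrite /vertex_stab /= star_act_lp // gc gs.
Qed.

(** An element fixing a point of the star of [c] fixes [c], whose stabilizer is a conjugate of
    [K]. *)
Lemma star_stab_compact c s i : coset_hull c s -> (0 < i <= L)%N ->
  compact (vertex_stab star_act (lpK c s i)).
Proof.
move=> hs /andP[i0 iL]; apply: subclosed_compact (stabC_compact (c := c)) _.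
  apply: open_subgroup_closed; last exact: star_stab_open.
  exact: stab_subgroup star_act1 star_actM _.
move=> g; rewrite /vertex_stab /= star_act_lp // => /(congr1 (@star _ _ _ _)).
by rewrite !star_lp // => -[].
Qed.

(** The stars are permuted transitively, so the finite star of the trivial coset is added to the
    given finite data. Spokes are listed in both directions because edges are covered as ordered
    pairs. *)
Lemma star_cocompact : cocompact_action star_adj star_act.
Proof.
have [K0 [L0 [fK0 fL0 K0P L0P]]] := ca_cocompact (rg_ca D).
pose c0 : C := coset K 1.
have lift c s : coset_hull c s -> exists g h, [/\ H h, coset_hull c0 h,
    c = actC g c0 & s = act g h].
  have [g ->] := coset_surj c; rewrite coset_hullE => -[h Hh <-].
  exists g, h; split=> //; last by rewrite (coset_actE sK) mulg1.
  by rewrite coset_hullE; exists h.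
exists ((@vX _ _ _ _ @` K0) `|` ((fun q => lpK c0 q.1 q.2) @` (H `*` `I_L.+1))).
exists (((fun l => (vX _ _ l.1, vX _ _ l.2)) @` L0) `|`
  ((fun q => (lpK c0 q.1 q.2, lpK c0 q.1 q.2.+1)) @` (H `*` `I_L)) `|`
  ((fun q => (lpK c0 q.1 q.2.+1, lpK c0 q.1 q.2)) @` (H `*` `I_L))).
split.
- rewrite finite_setU; split; apply: finite_image => //.
  by apply: finite_setX => //; exact: finite_II.
- rewrite !finite_setU; split; first split; apply: finite_image => //;
    by apply: finite_setX => //; exact: finite_II.
- move=> p; case: (starP p) => [[x ->]|[c [s [i [hs /andP[_ iL] ->]]]]].
    have [k Kk [g gx]] := K0P x; exists (vX _ _ k); first by left; exists k.
    by exists g; rewrite /= gx.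
  have [g [h [Hh hc0 -> ->]]] := lift c s hs.
  exists (lpK c0 h i); first by right; exists (h, i).
  by exists g; rewrite star_act_lp.
- have spokeP u v : @spoke X C coset_hull L u v -> exists g h i,
      [/\ H h, (i < L)%N, star_act g (lpK c0 h i) = u & star_act g (lpK c0 h i.+1) = v].
    move=> [c [s [i [hs iL -> ->]]]]; have [g [h [Hh hc0 -> ->]]] := lift c s hs.
    by exists g, h, i; split=> //; rewrite star_act_lp // ltnW.
  move=> p q /asboolP[[x [y [-> -> xy]]]|/spokeP|/spokeP].
  + have [l Ll [g [gx gy]]] := L0P x y xy.
    exists (vX _ _ l.1, vX _ _ l.2); first by left; left; exists l.
    by exists g; rewrite /= gx gy.
  + move=> [g [h [i [Hh iL gp gq]]]].
    exists (lpK c0 h i, lpK c0 h i.+1); first by left; right; exists (h, i).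
    by exists g.
  + move=> [g [h [i [Hh iL gp gq]]]].
    exists (lpK c0 h i.+1, lpK c0 h i); first by right; exists (h, i).
    by exists g.
Qed.

Lemma star_cayley_abels : cayley_abels star_adj star_act HH.
Proof.
apply: cayley_abels_fine.
- exact: star_simplicial.
- exact: star_connected.
- exact: star_acts.
- exact: star_cocompact.
- exact: star_stab_open.
- have spoke_compact u v : @spoke X C coset_hull L u v -> compact (vertex_stab star_act v).
    by move=> [c [s [i [hs iL _ ->]]]]; exact: star_stab_compact.
  have clI u v : closed (vertex_stab star_act u `&` vertex_stab star_act v).
    by apply: closedI; apply: (stab_closed star_act1 star_actM); exact: star_stab_open.
  move=> p q /asboolP[[x [y [-> -> xy]]]|/spoke_compact cs|/spoke_compact cs].
  + by rewrite !star_stab_vX; exact: pair_compact.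
  + by apply: subclosed_compact cs _; first exact: clI; move=> g [].
  + by apply: subclosed_compact cs _; first exact: clI; move=> g [].
- move=> p; case: (starP p) => [[x ->]|[c [s [i [hs iL ->]]]]].
    by rewrite star_stab_vX; exact: (ca_vertices (rg_ca D)).
  by left; exact: star_stab_compact.
- move=> H0 /(ca_parabolics (rg_ca D))[x xH]; exists (vX _ _ x).
  by rewrite star_stab_vX.
- exact: star_fine.
Qed.

Definition star_relhyp : relhyp_graph HH :=
  RelHypGraph star_cayley_abels star_fine star_hyperbolic.

End AddFixedVertex.

(** The equivariant map [j] preserves the fixed vertices obtained earlier, so the construction can
    be repeated for several subgroups. *)
Lemma add_fixed_vertex (G : topologicalGroupType) (HH : set (set G))
    (D : relhyp_graph HH) (K : set G) :
  is_subgroup K -> open K -> compact K ->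
  exists (D' : relhyp_graph HH) (j : rg_vert D -> rg_vert D'),
    (forall g x, rg_act g (j x) = j (rg_act g x)) /\
    exists x, forall k, K k -> rg_act (r := D') k x = x.
Proof.
move=> sK oK cK; have ca := rg_ca D.
have ost x : open (vertex_stab (rg_act (r := D)) x).
  by have [+ _] := ca_discrete ca; apply.
have [aC _] := ca_simplicial ca.
have [H [L [fH H0 KH L0 HL]]] :=
  invariant_hull (ca_action ca) aC (ca_connected ca) ost sK cK.
exists (star_relhyp sK oK cK fH H0 KH L0 HL), (@vX _ _ _ _).
split=> //; exists (ctr _ _ (coset K 1)) => k Kk /=; congr (inl (inr _)).
have := coset_stab1 sK => E; move: Kk; rewrite -{1}E; exact.
Qed.

(** * Sides of the edges of the Bass-Serre tree *)

Section TreeSides.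
Variables (Z : finite_graph) (T : {set edge Z}).

Definition dstep (S : {set edge Z}) : rel (vert Z) :=
  fun a b => [exists d : edge Z * bool, [&& d.1 \in S, dorg d == a & dter d == b]].

Lemma dstep_walk S x q : path (dstep S) x q ->
  exists2 p, walk_in S x p (last x q) & rcons (map (@dorg Z) p) (last x q) = x :: q.
Proof.
elim: q x => [|y q IH] x /=; first by exists [::]; rewrite /walk_in /= ?eqxx.
case/andP=> /existsP[d /and3P[dS dx dy]] /IH[p /andP[pS wp] pE].
exists (d :: p); first by rewrite /walk_in /= dS pS dx (eqP dy).
by rewrite /= pE (eqP dx).
Qed.

Lemma walk_dter u p z d : walk u p z -> d \in p ->
  dter d \in behead (rcons (map (@dorg Z) p) z).
Proof.
elim: p u => //= d' p IH u /andP[_ w]; rewrite inE => /orP[/eqP->|dp]; last first.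
  by have := IH _ w dp; move: (rcons _ _) => [|a s] //= h; rewrite inE h orbT.
case: p w {IH} => [/eqP->|d1 p] /=; first by rewrite mem_head.
by case/andP=> /eqP-> _; rewrite mem_head.
Qed.

(** An edge used twice repeats its origin if the directions agree; otherwise the second passage ends
    where the first began. *)
Lemma walk_uniq_edges u p z : walk u p z -> uniq (rcons (map (@dorg Z) p) z) ->
  uniq (map fst p).
Proof.
elim: p u => //= d p IH u /andP[_ w] /andP[nd up].
rewrite (IH _ w up) andbT; apply/negP => /mapP[d' d'p dE].
have [bE|bE] := eqVneq d.2 d'.2.
  have dd' : d = d' by rewrite (surjective_pairing d) dE bE -surjective_pairing.
  by case/negP: nd; rewrite mem_rcons inE dd' map_f ?orbT.
case/negP: nd; have := walk_dter w d'p => /mem_behead; have -> // : dter d' = dorg d.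
rewrite /dter /dorg dE; congr ends.
by move: bE; case: (d.2); case: (d'.2).
Qed.

(** If [e0] lies in the tree, [s] is the indicator of the component of one of its ends after [e0] is
    removed; otherwise [s] is constant. *)
Lemma tree_side (e0 : edge Z) : maximal_tree T ->
  exists s : vert Z -> bool, forall e, e \in T ->
    s (ends e false) (+) s (ends e true) = (e == e0).
Proof.
move=> [_ acyclic]; have [e0T|ne0T] := boolP (e0 \in T); last first.
  exists (fun=> false) => e eT; rewrite addbb; apply/esym/negbTE.
  by apply: contra ne0T => /eqP<-.
pose r := dstep (T :\ e0).
exists (connect r (ends e0 true)) => e eT; have [->|ee0] := eqVneq e e0.
  rewrite connect0 addbT; apply/negP => /connectP[q0 wq0 lq].
  case/shortenP: wq0 lq => q /dstep_walk[p wp pE] uq _ {q0} lq.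
  rewrite -lq in wp pE; case/andP: (wp) => /allP pT w.
  have e0p d : d \in p -> d.1 != e0 by move=> /pT; rewrite !inE => /andP[].
  have up : uniq (rcons (map (@dorg Z) p) (ends e0 false)) by rewrite pE.
  (* If the ends of [e0] were still connected, crossing [e0] and returning along [p] would be a
     circuit in the tree. *)
  case/negP: (acyclic (ends e0 false) ((e0, true) :: p)).
  apply/and4P; split=> //.
  - rewrite /walk_in /= e0T /dorg /= eqxx /= w andbT.
    by apply/allP => d /pT; rewrite !inE => /andP[].
  - by move: up; rewrite rcons_uniq.
  - rewrite /= (walk_uniq_edges w up) andbT; apply/mapP => -[d /e0p + dE].
    by rewrite -dE eqxx.
suff E : connect r (ends e0 true) (ends e false) = connect r (ends e0 true) (ends e true).
  by rewrite E addbb.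
have st b : connect r (ends e (~~ b)) (ends e b).
  by apply: connect1; apply/existsP; exists (e, b); rewrite !inE ee0 eT /dorg /dter /= !eqxx.
by apply/idP/idP => h; apply: connect_trans h _; [exact: (st true)|exact: (st false)].
Qed.

End TreeSides.

(** * A derivation of the fundamental group and its potential *)

Section BassSerreSides.
Variables (Z : finite_graph) (GG : graph_of_groups Z) (T : {set edge Z}).
Variables (Gam : topologicalGroupType) (phi : pi1 GG T -> Gam).
Hypotheses (phiM : group_hom phi) (phi_bij : bijective phi).

Local Notation word := (seq (letter GG)).

Definition ev (w : word) : Gam := phi (pi1_class T w).
Definition iv (v : vert Z) (g : vgroup GG v) : Gam := phi (pi1_vert T g).
Definition stable_letter (e : edge Z) : Gam := ev [:: ELetter GG e true].

Local Notation tl := stable_letter.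

Lemma ev_cat w w' : ev (w ++ w') = ev w * ev w'.
Proof. by rewrite /ev -pi1_mulE phiM. Qed.

Lemma ev_nil : ev [::] = 1.
Proof. by apply: (mulgI (ev [::])); rewrite -ev_cat mulg1. Qed.

Lemma ev_cons l w : ev (l :: w) = ev [:: l] * ev w.
Proof. by rewrite -cat1s ev_cat. Qed.

Lemma ev_rel w w' : pi1_rel T w w' -> ev w = ev w'.
Proof. by move=> h; congr phi; apply/pi1_classP. Qed.

Lemma ev_inj w w' : ev w = ev w' -> pi1_rel T w w'.
Proof. by move=> /(bij_inj phi_bij) /pi1_classP. Qed.

Lemma ev_surj g : exists w, ev w = g.
Proof.
have [psi _ psiK] := phi_bij; exists (repr (psi g)).
by rewrite /ev pi1_classK psiK.
Qed.

Lemma ivE v (g : vgroup GG v) : ev [:: VLetter v g] = iv g. Proof. by []. Qed.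

Lemma ivM v (g h : vgroup GG v) : iv (g * h) = iv g * iv h.
Proof. by rewrite -!ivE -ev_cat; apply/esym/ev_rel; exact: pi1_vertexM. Qed.

Lemma iv1 v : iv (1 : vgroup GG v) = 1.
Proof. by apply: (mulgI (iv (1 : vgroup GG v))); rewrite -ivM !mulg1. Qed.

Lemma ivV v (g : vgroup GG v) : iv g^-1 = (iv g)^-1.
Proof. by apply: (mulgI (iv g)); rewrite -ivM !mulgV iv1. Qed.

Lemma ev_ELetterV e : ev [:: ELetter GG e false] = (tl e)^-1.
Proof.
by apply: (mulgI (tl e)); rewrite mulgV -ev_cat -ev_nil; apply: ev_rel; exact: pi1_edgeV.
Qed.

Lemma stable_letterJ e (a : egroup GG e) :
  tl e * iv (emb true a) * (tl e)^-1 = iv (emb false a).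
Proof.
by rewrite -ev_ELetterV -!ivE -!ev_cat; apply: ev_rel; exact: (pi1_edge T true a).
Qed.

Lemma stable_letter_tree e : e \in T -> tl e = 1.
Proof. by move=> eT; rewrite -ev_nil; apply: ev_rel; exact: pi1_tree. Qed.

Section Derivation.
Variables (e0 : edge Z) (s0 : vert Z -> bool).
Hypothesis s0P : forall e, e \in T ->
  s0 (ends e false) (+) s0 (ends e true) = (e == e0).

(* [deriv] is a derivation from the fundamental group to the module of
   functions from [Gam] to the field with two elements, and [eps] is the
   indicator function of the edge group of [e0]. *)
Definition eps (x : Gam) : bool := `[< exists a, x = iv (emb (e:=e0) false a) >].
(** On the group of [v] the derivation is the inner one given by [pot v]. This correction makes
    [edge_deriv e] vanish for [e] in [T], as the relation [t_e = 1] demands: by [s0P] the jump of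
    [s0] along [e] cancels the term of [e0]. *)
Definition pot (v : vert Z) (x : Gam) : bool := s0 v && eps x.
Definition edge_deriv (e : edge Z) (x : Gam) : bool :=
  pot (ends e false) x (+) ((e == e0) && eps x) (+) pot (ends e true) ((tl e)^-1 * x).

Definition letter_deriv (l : letter GG) (x : Gam) : bool :=
  match l with
  | VLetter v g => pot v x (+) pot v ((iv g)^-1 * x)
  | ELetter e true => edge_deriv e x
  | ELetter e false => edge_deriv e (tl e * x)
  end.

Fixpoint deriv (w : word) (x : Gam) : bool :=
  if w is l :: w' then letter_deriv l x (+) deriv w' ((ev [:: l])^-1 * x) else false.

Lemma deriv_cat w w' x : deriv (w ++ w') x = deriv w x (+) deriv w' ((ev w)^-1 * x).
Proof.
elim: w x => [|l w IH] x /=; first by rewrite ev_nil invg1 mul1g.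
by rewrite IH (ev_cons l w) invgM addbA mulgA.
Qed.

Lemma eps_emb (a : egroup GG e0) x : eps ((iv (emb false a))^-1 * x) = eps x.
Proof.
have hom := @emb_hom Z GG e0 false.
apply/asboolP/asboolP => -[b xE].
  by exists (a * b); rewrite hom ivM -xE mulVKg.
exists (a^-1 * b); rewrite xE -ivV -ivM; congr iv.
by apply: (mulgI (emb false a)); rewrite -hom mulVKg mulgA mulgV mul1g.
Qed.

(** The inner terms are compatible with conjugation by stable letters; the additional term of [e0]
    respects the edge relation because [eps] is invariant under the edge group. *)
Lemma deriv_rel w w' : pi1_rel T w w' -> forall x, deriv w x = deriv w' x.
Proof.
elim=> {w w'} //.
- by move=> w w' w'' _ IH _ IH' x; rewrite IH IH'.
- move=> w1 w1' w2 w2' r1 IH1 _ IH2 x.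
  by rewrite !deriv_cat IH1 IH2 (ev_rel r1).
- by move=> v x /=; rewrite iv1 invg1 mul1g addbb.
- move=> v g h x /=; rewrite ivE ivM invgM -mulgA addbF.
  by rewrite !addbF; case: (pot v x); case: (pot v _); case: (pot v _).
- by move=> e [] x /=; rewrite ?ev_ELetterV ?invgK ?mulVKg ?mulKg addbF addbb.
- move=> e [] a x /=; rewrite ?ev_ELetterV ?invgK ivE !addbF /edge_deriv -/(tl e).
    have E : tl e * ((iv (emb true a))^-1 * ((tl e)^-1 * x)) =
        (iv (emb false a))^-1 * x.
      by rewrite -stable_letterJ !invgM invgK !mulgA.
    rewrite E; have -> : (tl e)^-1 * ((iv (emb false a))^-1 * x) =
        (iv (emb true a))^-1 * ((tl e)^-1 * x) by rewrite -E mulKg.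
    have -> : (e == e0) && eps ((iv (emb false a))^-1 * x) = (e == e0) && eps x.
      case: eqP => // ee0; subst e; exact: eps_emb.
    by case: (pot _ _); case: (pot _ _); case: (pot _ _); case: (pot _ _);
       case: (_ && eps x).
  have E : (tl e)^-1 * ((iv (emb false a))^-1 * (tl e * x)) = (iv (emb true a))^-1 * x.
    by rewrite -stable_letterJ !invgM invgK !mulgA mulVg mul1g mulgVK.
  rewrite E mulKg.
  have -> : (e == e0) && eps ((iv (emb false a))^-1 * (tl e * x)) =
      (e == e0) && eps (tl e * x).
    case: eqP => // ee0; subst e; exact: eps_emb.
  by case: (pot _ _); case: (pot _ _); case: (pot _ _); case: (pot _ _);
     case: (_ && eps (tl e * x)).
- move=> e b eT x /=; rewrite addbF.
  have z y : edge_deriv e y = false.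
    rewrite /edge_deriv stable_letter_tree // invg1 mul1g /pot -(s0P eT).
    by case: (s0 _); case: (s0 _); case: (eps _).
  by case: b.
Qed.

End Derivation.

(** The value at the vertex [g G_v] of the Bass-Serre tree is the derivation of [g] evaluated at
    [g0], plus the value of [pot] that makes it depend on the coset only. Along a stable letter
    everything cancels except the term of [e0]. *)
Lemma side_function (T_tree : maximal_tree T) (e0 : edge Z) (g0 : Gam) :
  exists sg : Gam -> vert Z -> bool,
    (forall g v (h : vgroup GG v), sg (g * iv h) v = sg g v) /\
    forall g e, sg g (ends e false) (+) sg (g * tl e) (ends e true) =
      (e == e0) && eps e0 (g^-1 * g0).
Proof.
have [s0 s0P] := tree_side e0 T_tree.
have [wd wdP] := choice ev_surj.
have D w g : ev w = g -> deriv e0 s0 (wd g) g0 = deriv e0 s0 w g0.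
  by move=> wg; apply: deriv_rel s0P _ _ _ _; apply: ev_inj; rewrite wdP.
exists (fun g v => deriv e0 s0 (wd g) g0 (+) pot e0 s0 v (g^-1 * g0)).
split=> [g v h|g e].
  rewrite (D (wd g ++ [:: VLetter v h])); last by rewrite ev_cat wdP.
  rewrite deriv_cat wdP /= addbF invgM -[(_ * _) * g0]mulgA.
  by case: (deriv _ _ _ _); case: (pot _ _ _ _); case: (pot _ _ _ _).
rewrite (D (wd g ++ [:: ELetter GG e true]) (g * tl e)); last by rewrite ev_cat wdP.
rewrite deriv_cat wdP /= addbF /edge_deriv invgM -[(_ * _) * g0]mulgA.
case: (deriv _ _ _ _); case: (pot _ _ _ _); case: (pot _ _ _ _);
  by case: (_ && eps _ _).
Qed.

End BassSerreSides.

(** * Open embeddings and edge groups *)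

Section OpenEmbedding.
Variables (U G : topologicalGroupType) (f : U -> G).
Hypotheses (fM : group_hom f) (f_open : open_embedding f).

Lemma group_hom1 : f 1 = 1.
Proof. by apply: (mulgI (f 1)); rewrite -fM !mulg1. Qed.

Lemma group_homV u : f u^-1 = (f u)^-1.
Proof. by apply: (mulgI (f u)); rewrite -fM !mulgV group_hom1. Qed.

Lemma image_subgroup (H : set U) : is_subgroup H -> is_subgroup (f @` H).
Proof.
move=> [H1 HM HV]; split; first by exists 1; rewrite ?group_hom1.
- by move=> _ _ [u Hu <-] [v Hv <-]; exists (u * v); [exact: HM|exact: fM].
- by move=> _ [u Hu <-]; exists u^-1; [exact: HV|exact: group_homV].
Qed.

Lemma image_compact (H : set U) : compact H -> compact (f @` H).
Proof.
have [_ fc _] := f_open.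
by apply: continuous_compact; exact: continuous_subspaceT.
Qed.

Lemma image_open (H : set U) : open H -> open (f @` H).
Proof. by have [_ _] := f_open; apply. Qed.

Lemma range_closed : closed (range f).
Proof.
apply: open_subgroup_closed; last exact: (image_open openT).
exact: image_subgroup.
Qed.

Lemma image_closed (C : set U) : closed C -> closed (f @` C).
Proof.
have [fI _ _] := f_open => cC.
have -> : f @` C = range f `&` ~` (f @` ~` C).
  apply/seteqP; split => [_ [u Cu <-]|_ [[u _ <-] nCu]].
    by split; [exists u|move=> [v nCv /fI vu]; apply: nCv; rewrite vu].
  by exists u => //; apply: contrapT => nu; apply: nCu; exists u.
apply: closedI; first exact: range_closed.
by apply: open_closedC; apply: image_open; exact: closed_openC.
Qed.

Lemma closed_translate (x : G) (C : set G) : closed C -> closed [set x * y * 1 | y in C].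
Proof.
move=> cC; rewrite -[X in closed X]setCK; apply: open_closedC.
have -> : ~` [set x * y * 1 | y in C] = [set x * y * 1 | y in ~` C].
  apply/seteqP; split => [z nz|_ [y nCy <-] [y' Cy']].
    exists (x^-1 * z); last by rewrite mulg1 mulVKg.
    by move=> Cz; apply: nz; exists (x^-1 * z); rewrite // mulg1 mulVKg.
  by rewrite !mulg1 => /mulgI yE; apply: nCy; rewrite -yE.
by apply: open_translate; exact: closed_openC.
Qed.

(** A translate of the image of a compact neighbourhood of 1 gives local compactness. A connected
    set containing [x] stays in the clopen coset [x f(U)], and its preimage in [U] is connected,
    hence a point. *)
Lemma tdlc_open_embedding : tdlc U -> tdlc G.
Proof.
have [fI fc _] := f_open; move=> [td lc]; split; last first.
  move=> x _; have [W W1 [cW clW]] := lc 1 Logic.I.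
  have W1' : nbhs (1 : U) W.
    by move: W1; rewrite /within /= near_simpl; apply: filterS => u; apply.
  exists [set x * y * 1 | y in f @` W]; last first.
    have cfW := @compact_translate G x 1 _ (image_compact cW).
    by split=> //; apply: compact_closed cfW; exact: group_hausdorff.
  have : nbhs x [set x * y * 1 | y in f @` W].
    rewrite nbhsE; move: W1'; rewrite nbhsE => -[O [oO O1] OW].
    exists [set x * y * 1 | y in f @` O].
      split; first by apply: open_translate; exact: image_open.
      by exists 1; rewrite ?mulg1 //; exists 1; rewrite ?group_hom1.
    by move=> _ [_ [u Ou <-] <-]; exists (f u) => //; exists u => //; exact: OW.
  by apply: filterS => y ? _.
move=> x _; apply/seteqP; split => [y|_ ->]; last exact: connected_component_refl.
move=> [B [Bx _ cB] By].
pose xf (S : set U) := [set x * z * 1 | z in f @` S].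
have xfE (S : set U) u : xf S (x * f u) <-> S u.
  split=> [[_ [v Sv <-]]|Su]; first by rewrite mulg1 => /mulgI/fI <-.
  by exists (f u); rewrite ?mulg1 //; exists u.
have BxU : B `&` xf setT = B.
  apply: cB.
  - by exists x; split=> //; exists 1; rewrite ?mulg1 //; exists 1; rewrite ?group_hom1.
  - by exists (xf setT) => //; apply: open_translate; exact: image_open openT.
  - by exists (xf setT) => //; apply: closed_translate; exact: range_closed.
pose B' := [set u | B (x * f u)].
have cB' : connected B'.
  move=> S [u0 Su0] [O oO SO] [C cC SC].
  suff B'S : forall u, B' u -> S u.
    by apply/seteqP; split => // u; rewrite SO => -[].
  move=> u B'u; apply/(xfE S).
  have xS V : S = B' `&` V -> xf S = B `&` xf V.
    move=> SV; apply/seteqP; split => [_ [_ [v Sv <-] <-]|z [Bz [_ [v Vv <-] zE]]].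
      rewrite mulg1; move: Sv; rewrite SV => -[B'v Vv].
      by split=> //; apply/(xfE V).
    by rewrite -zE mulg1; apply/(xfE S); rewrite SV; split; rewrite // /B' /= -[x * _]mulg1 zE.
  rewrite (cB (xf S)) //.
  - by exists (x * f u0); apply/(xfE S).
  - by exists (xf O); [apply: open_translate; exact: image_open|exact: xS].
  - by exists (xf C); [apply: closed_translate; exact: image_closed|exact: xS].
have : B y by []; rewrite -BxU => -[_ [_ [u _ <-] yE]].
have B'1 : B' 1 by rewrite /B' /= group_hom1 mulg1.
have B'u : B' u by rewrite /B' /= -[x * _]mulg1 yE.
have : connected_component [set: U] 1 u.
  by apply: (@connected_component_max _ setT B') => //.
by rewrite td // => uE; rewrite -yE uE group_hom1 !mulg1.
Qed.

End OpenEmbedding.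

(** Induction along a list of oriented edges, enlarging the graph once for each one that ends at
    [v]. The transport [eq_rect] appears because [ends d.1 d.2] and [v] are equal only by the
    hypothesis [h]. *)
Lemma edge_fixed_vertices (Z : finite_graph) (GG : graph_of_groups Z)
    (edge_compact : forall e : edge Z, compact [set: egroup GG e])
    (v : vert Z) (HH : set (set (vgroup GG v))) (D0 : relhyp_graph HH)
    (s : seq (edge Z * bool)) :
  exists D : relhyp_graph HH, forall d, d \in s -> forall h : ends d.1 d.2 = v,
    exists x : rg_vert D, forall a : egroup GG d.1,
      rg_act (r := D) (eq_rect _ (fun u => vgroup GG u : Type) (emb d.2 a) v h) x = x.
Proof.
elim: s => [|d s [D DP]]; first by exists D0.
have [hd|nhd] := eqVneq (ends d.1 d.2) v; last first.
  exists D => d'; rewrite inE => /orP[/eqP->|/DP//] h.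
  by case/eqP: nhd.
(* Replacing [v] by the end of [d] makes the transport along [h] trivial. *)
move: HH D0 D DP; case: v / hd => HH D0 D DP.
have oe := @emb_open _ GG d.1 d.2; have he := @emb_hom _ GG d.1 d.2.
have sK : is_subgroup (range (@emb Z GG d.1 d.2)).
  by apply: (image_subgroup he (H := setT)); split.
have oK := image_open oe openT.
have cK := image_compact oe (edge_compact d.1).
have [D' [j [jact [x xP]]]] := add_fixed_vertex D sK oK cK.
exists D' => d'; have [->|dd'] := eqVneq d' d => d's h.
  exists x => a; rewrite (eq_irrelevance h erefl) /=.
  by apply: xP; exists a.
have [|y yP] := DP d' _ h; first by move: d's; rewrite inE (negbTE dd').
by exists (j y) => a; rewrite jact yP.
Qed.

(** * The glued graph *)

Section Glue.
Variables (Z : finite_graph) (GG : graph_of_groups Z) (T : {set edge Z}).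
Hypothesis T_tree : maximal_tree T.
Variables (Gam : topologicalGroupType) (phi : pi1 GG T -> Gam).
Hypothesis phi_pi1 : topological_pi1 phi.
Hypothesis edge_compact : forall e : edge Z, compact [set: egroup GG e].
Variable HH : forall v : vert Z, set (set (vgroup GG v)).
Arguments HH : clear implicits.
Variable D : forall v, relhyp_graph (HH v).
Variable x0 : forall e b, rg_vert (D (ends e b)).
Hypothesis x0_fixed : forall e b (a : egroup GG e),
  rg_act (r := D (ends e b)) (emb b a) (x0 e b) = x0 e b.

Local Notation X v := (rg_vert (D v)).
Local Notation adj v := (@rg_adj _ _ (D v)).
Local Notation act v := (@rg_act _ _ (D v)).
Local Notation iv := (iv phi).
Local Notation tl := (stable_letter phi).

Let phiM : group_hom phi. Proof. by case: phi_pi1. Qed.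
Let phi_bij : bijective phi. Proof. by case: phi_pi1. Qed.
Let iv_open v : open_embedding (@iv v). Proof. by case: phi_pi1. Qed.
Let iv_hom v : group_hom (@iv v). Proof. by move=> g h; exact: ivM. Qed.
Let ivI v : injective (@iv v). Proof. by case: (iv_open v). Qed.

Let a1 v x : act v 1 x = x.
Proof. by have [+ _ _] := ca_action (rg_ca (D v)); apply. Qed.
Let aM v g h x : act v (g * h) x = act v g (act v h x).
Proof. by have [_ + _] := ca_action (rg_ca (D v)); apply. Qed.
Let aa v g x y : adj v (act v g x) (act v g y) = adj v x y.
Proof. by have [_ _ +] := ca_action (rg_ca (D v)); apply. Qed.
Let aC v : symmetric (adj v). Proof. by have [] := ca_simplicial (rg_ca (D v)). Qed.
Let aI v : irreflexive (adj v). Proof. by have [] := ca_simplicial (rg_ca (D v)). Qed.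

(* The disjoint union over [v] of the spaces [Gam x_(G_v) X_v], whose points
   are represented by the classes [cl v g x] with [cl v (g h) x = cl v g (h x)]. *)
Definition pre_vert : Type := {v : vert Z & (Gam * X v)%type}.

Definition cl_set v (g : Gam) (x : X v) : set pre_vert :=
  [set p | exists h : vgroup GG v,
     p = Tagged (fun v => (Gam * X v)%type) (g * (iv h)^-1, act v h x)].

Definition is_class (c : set pre_vert) : Prop := exists v g (x : X v), c = cl_set g x.

Definition glued_vert : choiceType := {c : set pre_vert | `[< is_class c >]}.

Lemma is_class_gen v g (x : X v) : `[< is_class (cl_set g x) >].
Proof. by apply/asboolP; exists v, g, x. Qed.

Definition cl v g (x : X v) : glued_vert :=
  exist (fun c : set pre_vert => `[< is_class c >]) _ (is_class_gen g x).

Lemma cl_surj a : exists v g (x : X v), a = cl g x.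
Proof.
by case: a => c /[dup] /asboolP[v [g [x cE]]] h; exists v, g, x; apply: val_inj.
Qed.

Lemma cl_mul v g h (x : X v) : cl (g * iv h) x = cl g (act v h x).
Proof.
apply: val_inj => /=; apply/seteqP; split => _ [k ->].
  exists (k * h^-1); rewrite -aM mulgVK; congr Tagged; congr pair.
  by rewrite -(ivV phiM) -[in RHS](ivV phiM) -mulgA -(ivM phiM) invgM invgK.
exists (k * h); rewrite aM; congr Tagged; congr pair.
by rewrite -!(ivV phiM) -mulgA -(ivM phiM) invgM mulgA mulgV mul1g.
Qed.

Lemma cl_tag v v' g g' (x : X v) (x' : X v') : cl g x = cl g' x' -> v = v'.
Proof.
move=> /(congr1 val) /= E; have : cl_set g x (Tagged (fun v => (Gam * X v)%type) (g, x)).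
  by exists 1; rewrite a1 (iv1 phiM) invg1 mulg1.
by rewrite E => -[h /(congr1 (@tag _ _))].
Qed.

Lemma cl_eq v g g' (x x' : X v) : cl g x = cl g' x' ->
  exists h, g' = g * iv h /\ x = act v h x'.
Proof.
move=> /(congr1 val) /= E; have : cl_set g x (Tagged (fun v => (Gam * X v)%type) (g, x)).
  by exists 1; rewrite a1 (iv1 phiM) invg1 mulg1.
rewrite E => -[h hE]; have [gE xE] := eq_from_Tagged hE; exists h.
by rewrite xE {1}gE mulgVK.
Qed.

Lemma cl_inj v g : injective (@cl v g).
Proof.
move=> x y /cl_eq[h [gE ->]].
have : iv h = iv (1 : vgroup GG v) by rewrite (iv1 phiM); apply: (mulgI g); rewrite -gE mulg1.
by move=> /ivI ->; rewrite a1.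
Qed.

Lemma cl_lift (R : Type) (F : forall v, Gam -> X v -> R) :
  (forall v g h x, F v (g * iv h) x = F v g (act v h x)) ->
  exists F' : glued_vert -> R, forall v g x, F' (@cl v g x) = F v g x.
Proof.
move=> FP.
have ex a : exists y, forall v g x, a = @cl v g x -> y = F v g x.
  have [v [g [x ->]]] := cl_surj a; exists (F v g x) => v' g' x' E.
  have vv' := cl_tag E; subst v'; have [h [-> ->]] := cl_eq E.
  by rewrite FP.
by have [F' F'P] := choice ex; exists F' => v g x; apply: F'P.
Qed.

Lemma glued_act_ex : exists f : glued_vert -> Gam -> glued_vert,
  forall v g x k, f (@cl v g x) k = cl (k * g) x.
Proof.
have [f fP] := @cl_lift (Gam -> glued_vert) (fun v g x k => cl (k * g) x)
  (fun v g h x => funext (fun k => etrans (congr1 (fun y => cl y x) (mulgA k g _)) (cl_mul _ _ _))).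
by exists f => v g x k; rewrite fP.
Qed.

Definition glued_act (k : Gam) (a : glued_vert) : glued_vert :=
  sval (cid glued_act_ex) a k.

Lemma glued_actE k v g x : glued_act k (@cl v g x) = cl (k * g) x.
Proof. by rewrite /glued_act; case: cid => f /= ->. Qed.

Definition piece_adj (a b : glued_vert) : Prop :=
  exists v g x y, [/\ a = @cl v g x, b = cl g y & adj v x y].

(** The edge [g G_e] of the Bass-Serre tree, realised between the fixed vertices in the copies of
    the vertex graphs at the cosets of [g] and [g * tl e]. *)
Definition link (e : edge Z) (g : Gam) (a b : glued_vert) : Prop :=
  a = cl g (x0 e false) /\ b = cl (g * tl e) (x0 e true).

Definition bridge_adj (a b : glued_vert) : Prop := exists e g, link e g a b \/ link e g b a.

Local Notation E := (join_rel piece_adj bridge_adj).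

Lemma piece_sym : sym piece_adj.
Proof. by move=> _ _ [v [g [x [y [-> -> xy]]]]]; exists v, g, y, x; rewrite aC. Qed.

Lemma bridge_sym : sym bridge_adj.
Proof. by move=> a b [e [g [ab|ba]]]; exists e, g; [right|left]. Qed.

Lemma piece_cl v g x b : piece_adj (@cl v g x) b -> exists2 y, b = cl g y & edgeP (adj v) x y.
Proof.
move=> [v' [g' [x' [y' [aE -> xy]]]]]; have vv' := cl_tag aE; subst v'.
have [h [-> ->]] := cl_eq aE; exists (act v h y'); first exact: cl_mul.
by rewrite /edgeP aa.
Qed.

Lemma cl_piece v g (x y : X v) : edgeP (adj v) x y -> piece_adj (@cl v g x) (cl g y).
Proof. by move=> xy; exists v, g, x, y. Qed.

Lemma piece_walk_cl n v g x b : bwalk piece_adj n (@cl v g x) b ->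
  exists2 y, b = cl g y & bwalk (edgeP (adj v)) n x y.
Proof.
move: (erefl (cl g x)); move: {1 3}(cl g x) => a aE w.
elim: w x aE => {n a b} [n a|n a b c ab _ IH] x aE; subst a.
  by exists x => //; exact: bwalk0.
have [y bE xy] := piece_cl ab; have [z -> yz] := IH y bE.
by exists z => //; exact: bwalkS xy yz.
Qed.

Lemma cl_walk n v g (x y : X v) : bwalk (edgeP (adj v)) n x y ->
  bwalk piece_adj n (@cl v g x) (cl g y).
Proof. by apply: bwalk_map => a b ab; right; exact: cl_piece. Qed.

Lemma off_walk_cl n v g (t x : X v) b : bwalk (off (@cl v g t) piece_adj) n (cl g x) b ->
  exists2 y, b = cl g y & bwalk (off t (edgeP (adj v))) n x y.
Proof.
move: (erefl (cl g x)); move: {1 3}(cl g x) => a aE w.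
elim: w x aE => {n a b} [n a|n a b c [ab at_ bt] _ IH] x aE; subst a.
  by exists x => //; exact: bwalk0.
have [y bE xy] := piece_cl ab; have [z -> yz] := IH y bE.
exists z => //; apply: bwalkS yz; split=> // E'; first by apply: at_; rewrite E'.
by apply: bt; rewrite bE E'.
Qed.

Lemma piece_angfine : angfine piece_adj.
Proof.
move=> a b n; have [v [g [x ->]]] := cl_surj a => /piece_cl[y -> xy].
have fin : angfine (edgeP (adj v)).
  by apply: fine_angfine; [exact: ca_simplicial (rg_ca (D v))|exact: rg_fine].
apply: sub_finite_set (finite_image (@cl v g) (fin x y n xy)) => c [ac w].
have [z zE xz] := piece_cl ac; exists z => //; split=> //.
have [z' zE' w'] := off_walk_cl w.
by have -> : z = z' by apply: (@cl_inj _ g); rewrite -zE -zE'.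
Qed.

Lemma glued_piece_dist v g (x y : X v) n : bwalk (edgeP (adj v)) n x y ->
  dist piece_adj (@cl v g x) (cl g y) = dist (edgeP (adj v)) x y.
Proof.
move=> w; apply/eqP; rewrite eqn_leq; apply/andP; split.
  exact: dist_min (cl_walk g (dist_walk w)).
have [y' /cl_inj <- w'] := piece_walk_cl (dist_walk (cl_walk g w)).
exact: dist_min w'.
Qed.

Lemma edge_eps e g g0 : eps phi e (g^-1 * g0) ->
  exists a : egroup GG e, g0 = g * iv (emb false a).
Proof. by move=> /asboolP[a aE]; exists a; rewrite -aE mulVKg. Qed.

(** The edge group fixes both base vertices, so a link depends only on the coset of [g] by the edge
    group. *)
Lemma link_mul e g (a : egroup GG e) u w :
  link e (g * iv (emb false a)) u w -> link e g u w.
Proof.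
move=> [-> ->]; split; first by rewrite cl_mul x0_fixed.
have -> : g * iv (emb false a) * tl e = g * tl e * iv (emb true a).
  by rewrite -(stable_letterJ phiM) !mulgA mulgVK.
by rewrite cl_mul x0_fixed.
Qed.

Lemma link_eq e g a b a' b' : link e g a b -> link e g a' b' -> a = a' /\ b = b'.
Proof. by move=> [-> ->] [-> ->]. Qed.

(* The function [sg] separates the two sides of the edge [(e, g)] of the
   Bass-Serre tree. *)
Lemma link_side e g : exists sg : glued_vert -> bool,
  (forall a b, piece_adj a b -> sg a = sg b) /\
  forall e' g' a b, link e' g' a b ->
    sg a (+) sg b = (e' == e) && eps phi e (g'^-1 * g).
Proof.
have [s [sh st]] := side_function phiM phi_bij T_tree e g.
have [sg sgE] := @cl_lift bool (fun v g _ => s g v) (fun v g h x => sh g v h).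
exists sg; split.
  by move=> _ _ [v [k [x [y [-> -> _]]]]]; rewrite !sgE.
by move=> e' g' _ _ [-> ->]; rewrite !sgE st.
Qed.

Lemma eps1 e : eps phi e 1.
Proof.
have hom := @emb_hom _ GG e false.
by apply/asboolP; exists 1; rewrite (group_hom1 hom) (iv1 phiM).
Qed.

Lemma link_sides e g a b sg :
  (forall e' g' a b, link e' g' a b ->
    sg a (+) sg b = (e' == e) && eps phi e (g'^-1 * g)) ->
  link e g a b -> sg a <> sg b.
Proof. by move=> h /h; rewrite eqxx mulVg eps1; case: (sg a); case: (sg b). Qed.

Lemma piece_not_bridge a b : piece_adj a b -> ~ bridge_adj a b.
Proof.
move=> ab [e [g l]]; have [sg [sgp sgl]] := link_side e g.
have sab := sgp _ _ ab; by case: l => /(link_sides sgl); rewrite sab.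
Qed.

(** The side function jumps only at links of the same edge and the same coset, and by [link_mul]
    these all have the same endpoints. *)
Lemma bridge_side a b : bridge_adj a b -> exists sg, side piece_adj bridge_adj a b sg.
Proof.
move=> [e [g l]]; have [sg [sgp sgl]] := link_side e g; exists sg.
wlog l' : a b {l} / link e g a b.
  move=> H; case: l => l; first exact: H.
  have [ba sg2] := H _ _ l; split; first exact: nesym.
  by move=> x y xy /(sg2 _ _ xy) []; [right|left].
split; first exact: link_sides sgl l'.
have key e' g' x y : link e' g' x y -> sg x <> sg y -> x = a /\ y = b.
  move=> l2 xy; have := sgl _ _ _ _ l2.
  have -> : sg x (+) sg y by move: xy; case: (sg x); case: (sg y).
  move=> /esym/andP[/eqP ee' /edge_eps[k gE]]; subst e'.
  by apply: link_eq l2 _; apply: (@link_mul _ _ k); rewrite -gE.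
move=> x y [/sgp//|[e' [g' [l2|l2]]]] xy.
  by left; exact: key l2 xy.
by right; have [] := key _ _ _ _ l2 (nesym xy).
Qed.

Let gconn a b := exists n, bwalk E n a b.

Let gconnT a b c : gconn a b -> gconn b c -> gconn a c.
Proof. by move=> [n w] [m w']; exists (n + m)%N; exact: bwalk_cat w w'. Qed.

Let gconnC a b : gconn a b -> gconn b a.
Proof. by move=> [n w]; exists n; exact: bwalk_sym (join_sym piece_sym bridge_sym) w. Qed.

Let gconn_piece v g (x y : X v) : gconn (@cl v g x) (cl g y).
Proof.
have /graph_connectedP[_ conn] := ca_connected (rg_ca (D v)).
have [n w] := conn x y; exists n; apply: bwalk_sub (cl_walk g w) => a b; by left.
Qed.

Let gconn_link e g (x : X (ends e false)) (y : X (ends e true)) :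
  gconn (@cl (ends e false) g x) (@cl (ends e true) (g * tl e) y).
Proof.
apply: gconnT (gconn_piece g x (x0 e false)) _.
apply: gconnT (gconn_piece _ (x0 e true) y); exists 1%N; apply: bwalk1.
by right; exists e, g; left.
Qed.

Let gconn_link_tree e b g (x : X (ends e (~~ b))) (y : X (ends e b)) : e \in T ->
  gconn (@cl (ends e (~~ b)) g x) (@cl (ends e b) g y).
Proof.
move=> eT; have gE : g * tl e = g by rewrite (stable_letter_tree phiM) // mulg1.
case: b x y => /= x y; last apply: gconnC.
  by have := @gconn_link e g x y; rewrite gE.
by have := @gconn_link e g y x; rewrite gE.
Qed.

(** Stable letters of tree edges are trivial, so a walk in [T] connects the copies over one and the
    same [g]. *)
Let gconn_tree u v g (x : X u) (y : X v) : gconn (@cl u g x) (@cl v g y).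
Proof.
have [[_ /(_ u v)[p /andP[pT w]]] _] := T_tree.
elim: p u x pT w => [|d p IH] u x /=.
  by move=> _ /eqP uv; subst v; exact: gconn_piece.
move=> /andP[dT pT] /andP[/eqP du w]; subst u.
have [[z] _] := ca_connected (rg_ca (D (dter d))).
by apply: gconnT (IH _ z pT w); exact: gconn_link_tree.
Qed.

(** Letter by letter: a vertex letter stays in its copy, a stable letter crosses a link, and
    [gconn_tree] first leads to the copy where the letter applies. *)
Let gconn_word w u v g (x : X u) (y : X v) : gconn (@cl u g x) (@cl v (g * ev phi w) y).
Proof.
elim: w u g x => [|l w IH] u g x.
  by rewrite (ev_nil phiM) mulg1; exact: gconn_tree.
rewrite (ev_cons phiM) mulgA; case: l => [u' h|e [|]].
- have [[z] _] := ca_connected (rg_ca (D u')).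
  apply: gconnT (IH u' _ z); apply: gconnT (gconn_tree _ x (act u' h z)) _.
  by rewrite (ivE phi) cl_mul; exact: gconn_piece.
- apply: gconnT (IH (ends e true) _ (x0 e true)).
  by apply: gconnT (gconn_tree _ x (x0 e false)) _; exact: gconn_link.
- apply: gconnT (IH (ends e false) _ (x0 e false)).
  apply: gconnT (gconn_tree _ x (x0 e true)) _; apply: gconnC.
  rewrite (ev_ELetterV phiM); have := @gconn_link e (g * (tl e)^-1) (x0 e false) (x0 e true).
  by rewrite mulgVK.
Qed.

Lemma glued_conn a b : exists n, bwalk E n a b.
Proof.
have [v [g [x ->]]] := cl_surj a; have [v' [g' [x' ->]]] := cl_surj b.
have [w wE] := ev_surj phi_bij (g^-1 * g').
by have := gconn_word w g x x'; rewrite wE mulVKg.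
Qed.

Definition glued_adj : rel glued_vert := fun a b => `[< E a b >].

Lemma glued_adjE : edgeP glued_adj = E.
Proof.
by apply/funext => p; apply/funext => q; apply/propext; split => /asboolP.
Qed.

Lemma glued_simplicial : simplicial glued_adj.
Proof.
split=> [a b|a]; first by apply/asboolP/asboolP; exact: join_sym piece_sym bridge_sym _ _.
apply/asboolP => -[[v [g [x [y [-> /cl_inj <-]]]]]|/bridge_side[sg []]] //.
by rewrite aI.
Qed.

Lemma glued_connected : graph_connected glued_adj.
Proof.
apply/graph_connectedP; split; last by rewrite glued_adjE; exact: glued_conn.
have [[[v] _] _] := T_tree; have [[x] _] := ca_connected (rg_ca (D v)).
exact: (inhabits (cl 1 x)).
Qed.

Lemma glued_fine : fine glued_adj.
Proof.
apply: angfine_fine; first exact: glued_simplicial.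
rewrite glued_adjE; apply: join_angfine.
- exact: piece_sym.
- exact: piece_not_bridge.
- exact: bridge_side.
- exact: piece_angfine.
Qed.

Lemma glued_hyperbolic : gromov_hyperbolic glued_adj.
Proof.
apply/hyperbolic_fourpt; rewrite graph_distE glued_adjE.
have four v : exists N, fourpt (dist (edgeP (adj v))) N.
  by have /hyperbolic_fourpt[N] := rg_hyp (D v); rewrite graph_distE; exists N.
have [f fP] := choice four.
exists (\max_(v : vert Z) f v); apply: join_fourpt.
- exact: piece_sym.
- exact: bridge_sym.
- exact: piece_not_bridge.
- exact: bridge_side.
- exact: glued_conn.
move=> w x y z k1 k2 k3; have [v [g [w' ->]]] := cl_surj w.
move=> /piece_walk_cl[x' -> _] /piece_walk_cl[y' -> _] /piece_walk_cl[z' -> _].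
have /graph_connectedP[_ conn] := ca_connected (rg_ca (D v)).
have dE a b : dist piece_adj (@cl v g a) (cl g b) = dist (edgeP (adj v)) a b.
  by have [n wab] := conn a b; exact: glued_piece_dist wab.
rewrite !dE; apply: leq_trans (fP v w' x' y' z') _.
by rewrite leq_add2l; exact: leq_bigmax.
Qed.

Lemma glued_act1 a : glued_act 1 a = a.
Proof. by have [v [g [x ->]]] := cl_surj a; rewrite glued_actE mul1g. Qed.

Lemma glued_actM k l a : glued_act (k * l) a = glued_act k (glued_act l a).
Proof. by have [v [g [x ->]]] := cl_surj a; rewrite !glued_actE mulgA. Qed.

Lemma glued_act_link k e g a b : link e g a b ->
  link e (k * g) (glued_act k a) (glued_act k b).
Proof. by move=> [-> ->]; rewrite !glued_actE mulgA. Qed.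

Lemma glued_act_rel k a b : E a b -> E (glued_act k a) (glued_act k b).
Proof.
case=> [[v [g [x [y [-> -> xy]]]]]|[e [g [l|l]]]].
- by left; exists v, (k * g), x, y; rewrite !glued_actE.
- by right; exists e, (k * g); left; exact: glued_act_link.
- by right; exists e, (k * g); right; exact: glued_act_link.
Qed.

Lemma glued_acts : acts_on_graph glued_adj glued_act.
Proof.
split; [exact: glued_act1|exact: glued_actM|move=> k a b].
apply/asboolP/asboolP; last exact: glued_act_rel.
by move=> /(glued_act_rel k^-1); rewrite -!glued_actM mulVg !glued_act1.
Qed.

Local Notation stab := (vertex_stab glued_act).

Lemma glued_stab v g x :
  stab (@cl v g x) = conj_set g (@iv v @` vertex_stab (act v) x).
Proof.
rewrite -[g in LHS]mulg1 -glued_actE (stab_act glued_act1 glued_actM); congr conj_set.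
apply/seteqP; split => [k|_ [h hx <-]]; rewrite /vertex_stab /= glued_actE.
  move=> /cl_eq[h [hE xE]]; exists h^-1.
    by rewrite /vertex_stab /= {1}xE (actK (@a1 v) (@aM v)).
  by rewrite mulg1 in hE; rewrite (ivV phiM); apply: (mulIg (iv h)); rewrite mulVg -hE.
by rewrite mulg1 -[iv h]mul1g cl_mul hx.
Qed.

Lemma glued_stab_open a : open (stab a).
Proof.
have [v [g [x ->]]] := cl_surj a; rewrite glued_stab; apply: open_translate.
apply: image_open => //.
by have [+ _] := ca_discrete (rg_ca (D v)); apply.
Qed.

(** For a piece edge, the stabilizer is contained in a conjugate of the image of a compact one. For
    a bridge, it is contained in a conjugate of the edge group. *)
Lemma glued_pair_compact a b : E a b -> compact (stab a `&` stab b).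
Proof.
have clI u w : closed (stab u `&` stab w).
  by apply: closedI; apply: (stab_closed glued_act1 glued_actM); exact: glued_stab_open.
case=> [[v [g [x [y [-> -> xy]]]]]|[e [g l]]].
  have cxy : compact (vertex_stab (act v) x `&` vertex_stab (act v) y).
    have ost z : open (vertex_stab (act v) z).
      by have [+ _] := ca_discrete (rg_ca (D v)); apply.
    apply: (compact_pair_stab (@a1 v) (@aM v)) => //.
    exact: (ca_edges (rg_ca (D v))).
  apply: subclosed_compact (compact_translate (g := g) (h := g^-1)
    (image_compact (iv_open v) cxy)) _; first exact: clI.
  rewrite !glued_stab => _ [[_ [h hx <-] <-] [_ [h' hy <-] hE]].
  have /ivI hh' : iv h' = iv h by apply: (mulgI g); apply: (mulIg g^-1).
  by exists (iv h) => //; exists h => //; split=> //; rewrite -hh'.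
have cK : compact [set iv (@emb Z GG e false k) | k in [set: egroup GG e]].
  have oe := @emb_open _ GG e false.
  have := image_compact (iv_open _) (image_compact oe (edge_compact (e := e))).
  by rewrite image_comp.
apply: subclosed_compact (compact_translate (g := g) (h := g^-1) cK) _; first exact: clI.
wlog l' : a b {l} / link e g a b.
  by move=> H; case: l => l; [exact: H|rewrite setIC; exact: H].
(* The link of [k * g] has the same ends [a] and [b], so [sg] jumps along it. This puts [g] into the
   coset of [k * g] by the edge group, that is, [k] into its conjugate by [g]. *)
move=> k [ka kb]; have [sg [_ sgl]] := link_side e g.
have := sgl _ _ _ _ (glued_act_link k l'); rewrite ka kb.
have -> : sg a (+) sg b by move: (link_sides sgl l'); case: (sg a); case: (sg b).
move=> /esym/andP[_ /edge_eps[c gE]].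
exists (iv (emb false c^-1)); first by exists c^-1.
have hom := @emb_hom _ GG e false.
rewrite (group_homV hom) (ivV phiM) {1}gE mulgK.
by rewrite mulgK.
Qed.

Lemma glued_cocompact : cocompact_action glued_adj glued_act.
Proof.
have KL v := cid (ca_cocompact (rg_ca (D v))).
have LL v := cid (svalP (KL v)).
pose K v := sval (KL v); pose L v := sval (LL v).
have KLP v : [/\ finite_set (K v), finite_set (L v),
    forall x, exists2 k, K v k & exists g, act v g k = x &
    forall x y, adj v x y ->
      exists2 l, L v l & exists g, act v g l.1 = x /\ act v g l.2 = y].
  exact: svalP (LL v).
pose M e := (cl 1 (x0 e false), cl (1 * tl e) (x0 e true)).
exists (\bigcup_(v in [set: vert Z]) (@cl v 1 @` K v)).
exists ((\bigcup_(v in [set: vert Z]) ((fun l => (@cl v 1 l.1, @cl v 1 l.2)) @` L v)) `|`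
  (\bigcup_(e in [set: edge Z]) [set M e; ((M e).2, (M e).1)])).
split.
- apply: bigcup_finite; first exact: finite_finset.
  by move=> v _; apply: finite_image; have [] := KLP v.
- rewrite finite_setU; split; apply: bigcup_finite; try exact: finite_finset.
    by move=> v _; apply: finite_image; have [] := KLP v.
  by move=> e _; exact: finite_set2.
- move=> a; have [v [g [x ->]]] := cl_surj a.
  have [_ _ /(_ x)[k Kk [h hk]] _] := KLP v.
  exists (cl 1 k); first by exists v => //; exists k.
  by exists (g * iv h); rewrite glued_actE mulg1 cl_mul hk.
move=> a b /asboolP[[v [g [x [y [-> -> xy]]]]]|[e [g l]]].
  have [_ _ _ /(_ x y xy)[l Ll [h [hx hy]]]] := KLP v.
  exists (cl 1 l.1, cl 1 l.2); first by left; exists v => //; exists l.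
  by exists (g * iv h); rewrite !glued_actE /= mulg1 !cl_mul hx hy.
have gM : glued_act g (M e).1 = cl g (x0 e false) /\
    glued_act g (M e).2 = cl (g * tl e) (x0 e true).
  by rewrite !glued_actE /= mulg1 mul1g.
case: l => -[-> ->].
  by exists (M e); [right; exists e => //; left|exists g].
exists ((M e).2, (M e).1); first by right; exists e => //; right.
by exists g; have [] := gM.
Qed.

Definition glued_subgroups : set (set Gam) :=
  \bigcup_(v in [set: vert Z]) [set @iv v @` H | H in HH v].

Lemma glued_cayley_abels : cayley_abels glued_adj glued_act glued_subgroups.
Proof.
apply: cayley_abels_fine.
- exact: glued_simplicial.
- exact: glued_connected.
- exact: glued_acts.
- exact: glued_cocompact.
- exact: glued_stab_open.
- by move=> a b /asboolP; exact: glued_pair_compact.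
- move=> a; have [v [g [x ->]]] := cl_surj a; rewrite glued_stab.
  have [cx|[H HHH [h ->]]] := ca_vertices (rg_ca (D v)) x.
    by left; apply: compact_translate; exact: image_compact.
  right; exists (@iv v @` H); first by exists v => //; exists H.
  exists (g * iv h); apply/seteqP; split.
    move=> _ [_ [_ [k Hk <-] <-] <-]; exists (iv k); first by exists k.
    by rewrite !(ivM phiM) (ivV phiM) invgM !mulgA.
  move=> _ [_ [k Hk <-] <-]; exists (iv (h * k * h^-1)).
    by exists (h * k * h^-1) => //; exists k.
  by rewrite !(ivM phiM) (ivV phiM) invgM !mulgA.
- move=> _ [v _ [H HHH <-]]; have [x xH] := ca_parabolics (rg_ca (D v)) HHH.
  exists (cl 1 x); rewrite glued_stab xH; apply/seteqP; split.
    by move=> _ [k Hk <-]; rewrite invg1 mulg1 mul1g.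
  by move=> k Hk; exists k; rewrite // invg1 mulg1 mul1g.
- exact: glued_fine.
Qed.

Hypothesis HH_proper : forall v, proper_pair (HH v).

(** If the non-compact image of [K] is conjugate to the image of [H] by [g], it is the stabilizer of
    both [cl g x] and [cl 1 y]. These vertices coincide by fineness, so the conjugation already
    takes place in one vertex group, where properness applies. *)
Lemma glued_proper_pair : proper_pair glued_subgroups.
Proof.
split.
- have [[[v] _] _] := T_tree; have [td _ _ _] := HH_proper v.
  exact: tdlc_open_embedding td.
- apply: bigcup_finite; first exact: finite_finset.
  by move=> v _; apply: finite_image; have [] := HH_proper v.
- move=> _ [v _ [H HHH <-]]; have [_ _ /(_ H HHH)[sH oH] _] := HH_proper v.
  by split; [exact: image_subgroup|exact: image_open].
move=> _ _ [v _ [H HHH <-]] [w _ [K HHK <-]] ncH ncK [g KE].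
have [x xH] := ca_parabolics (rg_ca (D v)) HHH.
have [y yK] := ca_parabolics (rg_ca (D w)) HHK.
have pS : stab (cl g x) = @iv w @` K by rewrite glued_stab xH KE.
have qS : stab (cl 1 y) = @iv w @` K.
  rewrite glued_stab yK; apply/seteqP; split.
    by move=> _ [k Hk <-]; rewrite invg1 mulg1 mul1g.
  by move=> k Hk; exists k; rewrite // invg1 mulg1 mul1g.
have [pq|/eqP pq] := eqVneq (cl g x) (cl 1 y); last first.
  case: ncK; rewrite -(setIid (@iv w @` K)) -{1}pS -qS.
  have [_ _ aag] := glued_acts.
  apply: (fine_pair_stab_compact glued_act1 glued_actM aag) => //.
  - exact: glued_fine.
  - exact: glued_connected.
  - exact: glued_stab_open.
  - by move=> a b /asboolP; exact: glued_pair_compact.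
have vw := cl_tag pq; subst w; have [h [_ xE]] := cl_eq pq.
have [_ _ _ conj] := HH_proper v.
congr (_ @` _); apply/esym; apply: conj => //.
- by move=> cK; apply: ncK; exact: image_compact.
- by move=> cH; apply: ncH; exact: image_compact.
- by exists h; rewrite -xH xE (stab_act (@a1 v) (@aM v)) yK.
Qed.

End Glue.

Theorem theorem3p10 (Z : finite_graph) (Z_connected : finite_graph_connected Z)
    (GG : graph_of_groups Z) (HH : forall v : vert Z, set (set (vgroup GG v)))
    (HH_proper : forall v : vert Z, proper_pair (HH v))
    (HH_hyperbolic : forall v : vert Z, hyperbolic_relative (HH v))
    (edge_compact : forall e : edge Z, compact [set: egroup GG e])
    (T : {set edge Z}) (T_tree : maximal_tree T)
    (Gam : topologicalGroupType) (phi : pi1 GG T -> Gam)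
    (phi_pi1 : topological_pi1 phi) :
  hyperbolic_relative
    (\bigcup_(v in [set: vert Z])
       [set (fun g : vgroup GG v => phi (pi1_vert T g)) @` H | H in HH v]).
Proof.
have exD v : exists D : relhyp_graph (HH v), forall (d : edge Z * bool),
    d \in enum {: edge Z * bool} -> forall h : ends d.1 d.2 = v,
    exists x : rg_vert D, forall a : egroup GG d.1,
      rg_act (r := D) (eq_rect _ (fun u => vgroup GG u : Type) (emb d.2 a) v h) x = x.
  have [_ [X [adj [act [ca fin hyp]]]]] := HH_hyperbolic v.
  exact: (edge_fixed_vertices edge_compact (RelHypGraph ca fin hyp)).
pose D v := sval (cid (exD v)).
have exx e b : exists x : rg_vert (D (ends e b)), forall a : egroup GG e,
    rg_act (r := D (ends e b)) (emb b a) x = x.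
  (* At the end of the edge itself the equality is [erefl], and the transport reduces away. *)
  exact: (svalP (cid (exD (ends e b))) (e, b) (mem_enum _ _) erefl).
pose x0 e b := sval (cid (exx e b)).
have x0P e b a : rg_act (r := D (ends e b)) (emb b a) (x0 e b) = x0 e b.
  exact: (svalP (cid (exx e b))).
split; first exact: (glued_proper_pair T_tree phi_pi1 edge_compact x0P HH_proper).
exists (glued_vert phi D), (glued_adj x0), (@glued_act _ _ _ _ _ phi_pi1 _ D).
split.
- exact: (glued_cayley_abels T_tree phi_pi1 edge_compact x0P).
- exact: (glued_fine T_tree phi_pi1 x0P).
- exact: (glued_hyperbolic T_tree phi_pi1 x0P).
Qed.
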